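(* Let $H$ be a finite simple graph with $k$ vertices, $m$ edges and maximum degree $\Delta$, where $m\ge 1$, and let $u>1$. There are constants $c$, $C$ and $N_0$, depending only on $H$ and $u$, such that for every $N\ge N_0$ and every $p$ with $N^{-1/(m+3)}\le p\le 1-N^{-1}$, if $G=G(N,p)$ is the Erdős–Rényi random graph on $N$ vertices with edge probability $p$ and $X:=t(H,G)$, then $$1-\frac{c(\log N)^{b_1}}{N^{b_2}p^{b_3}}\le\frac{\psi_p(u)}{-\log\mathbb{P}(X\ge u\,\mathbb{E}(X))}\le 1+\frac{C(\log N)^{B_1}}{N^{B_2}p^{B_3}},$$ where $$b_1=1,\quad b_2=\frac1{2m},\quad b_3=\Delta,\qquad B_1=\frac{9+8m}{5+8m},\quad B_2=\frac1{5+8m},\quad B_3=\Delta-\frac{16m}{k(5+8m)}.$$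
   Context: For a finite simple graph $G$, $\hom(H,G)$ is the number of homomorphisms (edge-preserving maps) from $V(H)$ to $V(G)$, and the homomorphism density is $t(H,G):=\hom(H,G)/|V(G)|^{|V(H)|}$. Let $\mathcal{P}$ be the set of all arrays $x=(x_{ij})_{1\le i<j\le N}$ with each $x_{ij}\in[0,1]$; set $x_{ii}=0$ and $x_{ji}=x_{ij}$. With $H$ having vertex set $\{1,\ldots,k\}$ and edge set $E(H)$, for $x\in\mathcal{P}$ define $$t(H,x):=\frac1{N^k}\sum_{q_1,\ldots,q_k=1}^N\ \prod_{\{l,l'\}\in E(H)}x_{q_lq_{l'}}$$ (the expected value of $t(H,G_x)$, where $G_x$ is the random graph on $\{1,\dots,N\}$ with independent edges, edge $\{i,j\}$ being present with probability $x_{ij}$). For $v\in[0,1]$, $I_p(v):=v\log\frac vp+(1-v)\log\frac{1-v}{1-p}$ (with $0\log0=0$), and for $x\in\mathcal{P}$, $I_p(x):=\sum_{1\le i<j\le N}I_p(x_{ij})$. For $u>1$, $$\psi_p(u):=\inf\{I_p(x):x\in\mathcal{P}\text{ such that }t(H,x)\ge u\,\mathbb{E}(t(H,G))\},\qquad G=G(N,p).$$ *)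

(* Defs.v *)
From HB Require Import structures.
From mathcomp Require Import all_boot all_order all_algebra.
From mathcomp Require Import all_classical all_reals all_analysis.
Set Implicit Arguments.
Unset Strict Implicit.
Unset Printing Implicit Defensive.
Import Order.TTheory GRing.Theory Num.Theory.
Local Open Scope classical_set_scope.
Local Open Scope ring_scope.

(** Simple graphs on {0, ..., n-1}, by their adjacency matrix. *)
Definition is_sgraph (n : nat) (A : 'M[bool]_n) : bool :=
  [forall i, ~~ A i i] && [forall i, forall j, A i j == A j i].

Record sgraph (n : nat) := SGraph {
  adj :> 'M[bool]_n ;
  _ : is_sgraph adj
}.

HB.instance Definition _ n := [isSub for @adj n].
HB.instance Definition _ n := [Finite of sgraph n by <:].

Definition num_edges (n : nat) (G : sgraph n) : nat :=
  #|[pred e : 'I_n * 'I_n | (e.1 < e.2)%N && G e.1 e.2]|.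

Definition max_degree (n : nat) (G : sgraph n) : nat :=
  (\max_(i < n) #|[pred j : 'I_n | G i j]|)%N.

Definition hom (k n : nat) (H : sgraph k) (G : sgraph n) : nat :=
  #|[pred f : {ffun 'I_k -> 'I_n} |
      [forall i, forall j, H i j ==> G (f i) (f j)]]|.

Section Densities.
Variable R : realType.

Definition hom_density (k n : nat) (H : sgraph k) (G : sgraph n) : R :=
  (hom H G)%:R / n%:R ^+ k.

(** G(n,p): edges are independent, each present with probability [p], so a
    graph has the product weight over the pairs i < j. *)
Definition gnp (n : nat) (p : R) (G : sgraph n) : R :=
  \prod_(i < n) \prod_(j < n | (i < j)%N) (if G i j then p else 1 - p).

Definition gnp_Pr (n : nat) (p : R) (A : pred (sgraph n)) : R :=
  \sum_(G | A G) gnp p G.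

Definition gnp_E (n : nat) (p : R) (X : sgraph n -> R) : R :=
  \sum_G gnp p G * X G.

Definition arrays (n : nat) : set 'M[R]_n :=
  [set x : 'M[R]_n | [/\ forall i j, 0 <= x i j <= 1,
               forall i, x i i = 0 &
               forall i j, x j i = x i j]].

Definition array_density (k n : nat) (H : sgraph k) (x : 'M[R]_n) : R :=
  (n%:R ^+ k)^-1 *
  \sum_(q : {ffun 'I_k -> 'I_n})
    \prod_(l < k) \prod_(l' < k | (l < l')%N && H l l') x (q l) (q l').

(** Since [ln 0 = 0], this satisfies the convention 0 log 0 = 0. *)
Definition Ip (p v : R) : R :=
  v * ln (v / p) + (1 - v) * ln ((1 - v) / (1 - p)).

Definition Ip_array (n : nat) (p : R) (x : 'M[R]_n) : R :=
  \sum_(i < n) \sum_(j < n | (i < j)%N) Ip p (x i j).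

(** Extended-real valued: it is +oo when no array satisfies the constraint. *)
Definition psi (k n : nat) (H : sgraph k) (p u : R) : \bar R :=
  ereal_inf [set (Ip_array p x)%:E | x in
    [set x : 'M[R]_n | arrays x /\
       u * gnp_E p (fun G : sgraph n => hom_density H G)
         <= array_density H x]].

End Densities.

(* Main.v *)
(** Write [t(x)] for the density of an array, [L] for minus the logarithm of the
    upper-tail probability, [T] for the threshold [u E(X)], [D] for the maximum
    degree and [m] for the number of edges.

    Both inequalities are divided by the a priori bound [L >= c N^2 p^D], which
    comes from high moments of [X] (Janson, Oleszkiewicz, Rucinski): planting
    fewer than [c N^2 p^D] edges in [G(N,p)] hardly changes [E(X)], by Finner's
    generalised Hölder inequality, so [E(X^r)] stays below [((1+eps) p^m)^r] for
    [r] up to that order.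

    Lower bound on the ratio. Given an array [x] with [t(x) >= T], move it a
    fraction [N^(-1/(2m))] towards the complete graph. Under the product measure
    of the new array, Markov's inequality for the deficit [t(K_N) - X] gives the
    event probability at least [N^(-1/2)]. Changing measure back costs the
    relative entropy, which the move has raised by at most [N^(2-1/(2m)) log N],
    plus an error of order [N^(3/2) log N].

    Upper bound on the ratio. Every graph is within [eps] in cut norm of a
    signed sum of [O(eps^-2)] rectangles of height [eps], so the graphs fall into
    [exp(O(N eps^-2))] classes. The mean [x] of [G(N,p)] conditioned on an event
    [A] satisfies [P(A) <= exp(- Ip(x))], and when [A] is the part of the upper
    tail in one class, the counting lemma gives [t(x) >= T - 2 m eps]. Moving [x]
    slightly towards the complete graph makes it feasible. *)

Require Import Defs.
From mathcomp Require Import all_boot all_order all_algebra.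
From mathcomp Require Import all_classical all_reals all_analysis.
From mathcomp Require Import ring lra zify.
Set Implicit Arguments.
Unset Strict Implicit.
Unset Printing Implicit Defensive.
Import Order.TTheory GRing.Theory Num.Theory.
Local Open Scope ring_scope.

(** * Averages over maps between finite sets *)

Section Resampling.
Variables (R : realType) (k N : nat).
Implicit Types (q : {ffun 'I_k -> 'I_N}) (v w : 'I_k) (g : {ffun 'I_k -> 'I_N} -> R).

Definition upd q v (i : 'I_N) : {ffun 'I_k -> 'I_N} :=
  [ffun l => if l == v then i else q l].

Lemma updE q v i : upd q v i v = i.
Proof. by rewrite ffunE eqxx. Qed.

Lemma upd_neq q v w i : w != v -> upd q v i w = q w.
Proof. by move=> /negbTE h; rewrite ffunE h. Qed.

Lemma upd_upd q v i j : upd (upd q v i) v j = upd q v j.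
Proof. by apply/ffunP => l; rewrite !ffunE; case: eqP. Qed.

Lemma updC q v w i j : v != w -> upd (upd q v i) w j = upd (upd q w j) v i.
Proof.
move=> nvw; apply/ffunP => l; rewrite !ffunE.
by case: (altP (l =P w)) => // ->; rewrite eq_sym (negbTE nvw).
Qed.

Lemma sum_upd g v : \sum_q \sum_i g (upd q v i) = N%:R * \sum_q g q.
Proof.
rewrite pair_big /= mulr_sumr.
transitivity (\sum_(p : {ffun 'I_k -> 'I_N} * 'I_N) g p.1).
  (* Exchanging the value of [q] at [v] with the spare value [i] is an involution on the pairs
     [(q, i)]. *)
  rewrite [RHS](reindex_inj (h := fun p => (upd p.1 v p.2, p.1 v))) //=.
  apply: (@can_inj _ _ _ (fun p => (upd p.1 v p.2, p.1 v))) => -[q i] /=.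
  rewrite updE upd_upd; congr pair; apply/ffunP => l; rewrite ffunE.
  by case: eqP => [->|].
rewrite -(pair_big xpredT xpredT (fun q _ => g q)) /=.
by apply: eq_bigr => q _; rewrite sumr_const card_ord mulr_natl.
Qed.

Definition indep g v := forall q i, g (upd q v i) = g q.

Definition avgv v g q : R := N%:R^-1 * \sum_i g (upd q v i).

(** Turn [q] into [q'] one coordinate at a time; [mix s] has been changed on [s]. *)
Lemma indep_const g q q' : (forall v, indep g v) -> g q = g q'.
Proof.
move=> hg.
pose mix (s : seq 'I_k) := [ffun l => if l \in s then q' l else q l].
have mixP s : g (mix s) = g q.
  elim: s => [|v s <-]; first by congr g; apply/ffunP => l; rewrite ffunE.
  rewrite -(hg v (mix s) (q' v)); congr g; apply/ffunP => l.
  by rewrite !ffunE inE; case: eqP => [->|].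
rewrite -(mixP (enum 'I_k)); congr g; apply/ffunP => l.
by rewrite ffunE mem_enum.
Qed.

Hypothesis N0 : (0 < N)%N.

Lemma sum_avgv g v : \sum_q avgv v g q = \sum_q g q.
Proof.
by rewrite /avgv -mulr_sumr sum_upd mulKf // pnatr_eq0 -lt0n.
Qed.

Lemma indep_avgv g v : indep (avgv v g) v.
Proof.
move=> q i; congr (_ * _); apply: eq_bigr => j _; by rewrite upd_upd.
Qed.

Lemma indep_avgv_id g v q : indep g v -> avgv v g q = g q.
Proof.
move=> hg; rewrite /avgv (eq_bigr (fun=> g q)) => [|i _]; last exact: hg.
by rewrite sumr_const card_ord -[g q *+ N]mulr_natl mulKf // pnatr_eq0 -lt0n.
Qed.

Lemma indep_avgvW g v w : indep g w -> indep (avgv v g) w.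
Proof.
have [->|nvw] := eqVneq v w; first by move=> _; exact: indep_avgv.
move=> hg q i; congr (_ * _); apply: eq_bigr => j _.
by rewrite updC 1?eq_sym // hg.
Qed.

Lemma avg_const (c : R) : (N%:R ^+ k)^-1 * (\sum_(q : {ffun 'I_k -> 'I_N}) c) = c.
Proof.
rewrite sumr_const card_ffun !card_ord -[c *+ _]mulr_natl natrX mulKf //.
by rewrite expf_neq0 // pnatr_eq0 -lt0n.
Qed.

(** Under a uniformly random map the images of two distinct vertices are independent and uniform:
    resample both. *)
Lemma marginal (a b : 'I_k) (F : 'I_N -> 'I_N -> R) : a != b ->
  (N%:R ^+ k)^-1 * (\sum_(q : {ffun 'I_k -> 'I_N}) F (q a) (q b)) =
  (N%:R ^+ 2)^-1 * \sum_i \sum_j F i j.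
Proof.
move=> nab; have NN : N%:R != 0 :> R by rewrite pnatr_eq0 -lt0n.
rewrite -(sum_avgv _ b) -(sum_avgv _ a) /avgv.
under eq_bigr => q _ do under eq_bigr => i _ do
  under eq_bigr => j _ do rewrite upd_neq // !updE.
by rewrite avg_const -mulr_sumr mulrA expr2 invfM.
Qed.

End Resampling.

(** * Finner's generalised Hölder inequality *)

Section Finner.
Variable R : realType.

Lemma ln_le_sub1 (x : R) : 0 < x -> ln x <= x - 1.
Proof.
by move=> x0; have := @le_ln1Dx R (x - 1); rewrite [1 + _]addrC subrK; apply; rewrite ltrBrDr addNr.
Qed.

(** The arithmetic-geometric mean inequality for [D] numbers: the [y e], padded with [D - #|S|]
    ones. *)
Lemma agm_padded (I : finType) (S : {set I}) (D : nat) (y : I -> R) :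
  (0 < D)%N -> (#|S| <= D)%N -> (forall e, e \in S -> 0 <= y e) ->
  \prod_(e in S) y e `^ D%:R^-1 <= D%:R^-1 * (\sum_(e in S) y e + (D - #|S|)%:R).
Proof.
move=> D0 SD y0; have DR : 0 < D%:R :> R by rewrite ltr0n.
have [/existsP[e /andP[eS /eqP ye]]|] := boolP [exists e, (e \in S) && (y e == 0)].
  rewrite (bigD1 e) //= ye powR0 ?mul0r ?gt_eqF ?invr_gt0 //.
  by apply: mulr_ge0; rewrite ?invr_ge0 ?ler0n // addr_ge0 ?ler0n // sumr_ge0.
rewrite negb_exists => /forallP hy.
have {}y0 e : e \in S -> 0 < y e.
  by move=> eS; rewrite lt_def y0 // andbT; have := hy e; rewrite eS.
set Y := D%:R^-1 * _.
have Y0 : 0 < Y.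
  rewrite mulr_gt0 ?invr_gt0 //.
  have [->|[e eS]] := set_0Vmem S; first by rewrite big_set0 cards0 subn0 add0r.
  by rewrite (bigD1 e) //= -addrA ltr_wpDr ?y0 // addr_ge0 // sumr_ge0 // => f /andP[/y0/ltW].
have -> : \prod_(e in S) y e `^ D%:R^-1 = expR (D%:R^-1 * \sum_(e in S) ln (y e)).
  rewrite mulr_sumr expR_sum; apply: eq_bigr => e eS.
  by rewrite /powR gt_eqF ?y0.
rewrite -[leRHS](@lnK R) ?posrE // ler_expR ler_pdivrMl //.
(* Sum [ln z <= z - 1] over the ratios of the [D] padded numbers to their mean [Y]; the right-hand
   sides add up to 0. *)
have hs : \sum_(e in S) (ln (y e) - ln Y) <= \sum_(e in S) (y e / Y - 1).
  by apply: ler_sum => e eS; rewrite -ln_div ?posrE ?y0 // ln_le_sub1 // divr_gt0 ?y0.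
have hY : - ln Y <= Y^-1 - 1 by rewrite -lnV ?posrE // ln_le_sub1 // invr_gt0.
rewrite !sumrB !sumr_const -mulr_suml in hs.
have := ler_wpM2l (ler0n R (D - #|S|)) hY.
have eD : D%:R * Y = \sum_(e in S) y e + (D - #|S|)%:R by rewrite mulVKf ?gt_eqF.
have eD' : (\sum_(e in S) y e) / Y = D%:R - (D - #|S|)%:R / Y.
  by apply: (mulIf (lt0r_neq0 Y0)); rewrite mulrBl !divfK ?gt_eqF // eD addrK.
rewrite -[1 *+ _]/(#|S|%:R) -[ln Y *+ _]mulr_natl eD' in hs.
rewrite natrB // in hs * => h; lra.
Qed.

(** Normalise each function by its mean and apply [agm_padded] pointwise; averaging over [i] turns
    the padded mean into 1. *)
Lemma holder_mean (N : nat) (I : finType) (S : {set I}) (D : nat) (h : I -> 'I_N -> R) :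
  (0 < N)%N -> (0 < D)%N -> (#|S| <= D)%N -> (forall e i, 0 <= h e i) ->
  N%:R^-1 * (\sum_i \prod_(e in S) h e i `^ D%:R^-1) <=
  \prod_(e in S) (N%:R^-1 * \sum_i h e i) `^ D%:R^-1.
Proof.
move=> N0 D0 SD h0; have DR : 0 < D%:R :> R by rewrite ltr0n.
have NR : 0 < N%:R :> R by rewrite ltr0n.
pose M e := N%:R^-1 * \sum_i h e i.
have M0 e : 0 <= M e by rewrite mulr_ge0 ?invr_ge0 ?ler0n ?sumr_ge0 //.
(* A function with mean 0 vanishes identically and cannot be normalised, but then the left-hand side
   is 0. *)
have [/existsP[e /andP[eS]]|] := boolP [exists e, (e \in S) && (M e == 0)].
  rewrite mulf_eq0 invr_eq0 gt_eqF //= psumr_eq0 // => /allP he.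
  rewrite big1 ?mulr0 ?prodr_ge0 // => [f _|i _]; first exact: powR_ge0.
  rewrite (bigD1 e) //= (eqP (he i _)) ?mem_index_enum //.
  by rewrite powR0 ?mul0r ?gt_eqF ?invr_gt0.
rewrite negb_exists => /forallP hM.
have {}M0 e : e \in S -> 0 < M e.
  by move=> eS; rewrite lt_def M0 // andbT; have := hM e; rewrite eS.
have step i : \prod_(e in S) h e i `^ D%:R^-1 <= \prod_(e in S) M e `^ D%:R^-1 *
    (D%:R^-1 * (\sum_(e in S) h e i / M e + (D - #|S|)%:R)).
  apply: (@le_trans _ _ (\prod_(e in S) M e `^ D%:R^-1 * \prod_(e in S) (h e i / M e) `^ D%:R^-1)).
    rewrite -big_split /= le_eqVlt; apply/orP; left; apply/eqP/eq_bigr => e eS.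
    have Me := M0 e eS; rewrite -powRM ?divr_ge0 ?(ltW Me) //.
    by rewrite mulrC divfK ?gt_eqF.
  apply: ler_wpM2l; first by apply: prodr_ge0 => e _; exact: powR_ge0.
  by apply: agm_padded => // e eS; rewrite divr_ge0 ?(ltW (M0 e eS)).
apply: (le_trans (ler_wpM2l _ (ler_sum _ (fun i _ => step i)))).
  by rewrite invr_ge0 ltW.
rewrite -mulr_sumr mulrCA -mulr_sumr big_split /= exchange_big /= sumr_const card_ord.
have -> : \sum_(e in S) \sum_i h e i / M e = \sum_(e in S) N%:R.
  apply: eq_bigr => e eS; rewrite -mulr_suml.
  by rewrite -[X in X / _](mulVKf (lt0r_neq0 NR)) -/(M e) mulfK ?gt_eqF ?M0.
rewrite sumr_const -[N%:R *+ _]mulr_natr -[(D - #|S|)%:R *+ N]mulr_natl -mulrDr -natrD subnKC //.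
rewrite [X in _ * X](_ : _ = 1) ?mulr1 //.
by rewrite mulrCA mulKf ?gt_eqF // mulVf ?gt_eqF.
Qed.

(** One step of [finner]: factors not depending on [v] leave the average over that coordinate, and
    [holder_mean] treats the at most [D] others. *)
Lemma sum_prod_avgv (k N : nat) (I : finType) (D : nat) (dep : I -> 'I_k -> bool)
    (g : I -> {ffun 'I_k -> 'I_N} -> R) (A : {set I}) (v : 'I_k) :
  (0 < N)%N -> (0 < D)%N -> (#|[set e in A | dep e v]| <= D)%N ->
  (forall e q, 0 <= g e q) -> (forall e, ~~ dep e v -> indep (g e) v) ->
  \sum_q \prod_(e in A) g e q `^ D%:R^-1 <=
  \sum_q \prod_(e in A) avgv v (g e) q `^ D%:R^-1.
Proof.
move=> N0 D0 cD g0 gi; rewrite -(sum_avgv N0 _ v); apply: ler_sum => q _.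
have hsplit (F : I -> R) : \prod_(e in A) F e =
    \prod_(e in [set e in A | dep e v]) F e * \prod_(e in A | ~~ dep e v) F e.
  by rewrite (bigID (dep^~ v)) /=; congr (_ * _); apply: eq_bigl => e; rewrite inE.
rewrite [leRHS]hsplit /avgv /=.
have -> : \prod_(e in A | ~~ dep e v) (N%:R^-1 * \sum_i g e (upd q v i)) `^ D%:R^-1 =
    \prod_(e in A | ~~ dep e v) g e q `^ D%:R^-1.
  by apply: eq_bigr => e /andP[_ /gi h]; rewrite -/(avgv v (g e) q) indep_avgv_id.
under eq_bigr => i _.
  rewrite hsplit.
  rewrite [X in _ * X](_ : _ = \prod_(e in A | ~~ dep e v) g e q `^ D%:R^-1); last first.
    by apply: eq_bigr => e /andP[_ /gi ->].
  over.
rewrite -mulr_suml mulrA; apply: ler_wpM2r.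
  by apply: prodr_ge0 => e _; exact: powR_ge0.
exact: holder_mean.
Qed.

(* Averaging out the coordinates one after the other turns every [g e] into its
   mean; each step is Hölder's inequality for at most [D] functions. *)
Lemma finner (k N : nat) (I : finType) (D : nat) (dep : I -> 'I_k -> bool)
    (g : I -> {ffun 'I_k -> 'I_N} -> R) (A : {set I}) :
  (0 < N)%N -> (0 < D)%N -> (forall v, (#|[set e in A | dep e v]| <= D)%N) ->
  (forall e q, 0 <= g e q) -> (forall e v, ~~ dep e v -> indep (g e) v) ->
  (N%:R ^+ k)^-1 * (\sum_q \prod_(e in A) g e q `^ D%:R^-1) <=
  \prod_(e in A) ((N%:R ^+ k)^-1 * \sum_q g e q) `^ D%:R^-1.
Proof.
move=> N0 D0 cD g0 gi; have NR : 0 < N%:R :> R by rewrite ltr0n.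
pose G (s : seq 'I_k) e := foldr (fun v f => avgv v f) (g e) s.
have G0 s e q : 0 <= G s e q.
  elim: s q => [|v s IH] q //=.
  by rewrite mulr_ge0 ?invr_ge0 ?ler0n ?sumr_ge0 //.
have Gi s e v : ~~ dep e v || (v \in s) -> indep (G s e) v.
  elim: s => [|w s IH] /=; first by rewrite orbF; exact: gi.
  rewrite inE; have [->|_ /= h] := eqVneq v w; first by move=> _; exact: indep_avgv.
  by apply: indep_avgvW; exact: IH.
have Gs s e : \sum_q G s e q = \sum_q g e q.
  by elim: s => [|v s IH] //=; rewrite sum_avgv.
have Gm s : \sum_q \prod_(e in A) g e q `^ D%:R^-1 <= \sum_q \prod_(e in A) G s e q `^ D%:R^-1.
  elim: s => [|v s IH] //; apply: (le_trans IH) => /=.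
  by apply: (sum_prod_avgv (dep := dep)) => // e h; apply: Gi; rewrite h.
pose s := enum 'I_k.
have Gc e q : G s e q = (N%:R ^+ k)^-1 * \sum_q g e q.
  rewrite -(Gs s) (eq_bigr (fun=> G s e q)) => [|q' _]; last first.
    by apply: indep_const => // v; apply: Gi; rewrite mem_enum orbT.
  by rewrite avg_const.
apply: (le_trans (ler_wpM2l _ (Gm s))); first by rewrite invr_ge0 exprn_ge0 ?ler0n.
rewrite [X in _ * X <= _](eq_bigr (fun=> \prod_(e in A) ((N%:R ^+ k)^-1 * \sum_q g e q) `^ D%:R^-1)) => [|q _]; last first.
  by apply: eq_bigr => e _; rewrite Gc.
by rewrite avg_const.
Qed.

End Finner.

(** * Homomorphism densities of arrays *)

Section Edges.
Variables (k : nat) (H : sgraph k).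

Lemma sgraph_irr n (G : sgraph n) i : G i i = false.
Proof. by case: G => A /= /andP[/forallP h _]; apply/negbTE. Qed.

Lemma sgraph_sym n (G : sgraph n) i j : G i j = G j i.
Proof. by case: G => A /= /andP[_ /forallP/(_ i)/forallP/(_ j)/eqP]. Qed.

Definition edges : {set 'I_k * 'I_k} := [set e : 'I_k * 'I_k | (e.1 < e.2)%N && H e.1 e.2].

Definition incident (e : 'I_k * 'I_k) v := (e.1 == v) || (e.2 == v).

Lemma num_edgesE : num_edges H = #|edges|.
Proof. by apply: eq_card => e; rewrite !inE. Qed.

Lemma edges_neq e : e \in edges -> e.1 != e.2.
Proof. by rewrite inE => /andP[h _]; rewrite neq_ltn h. Qed.

(** Distinct edges of a simple graph share at most one endpoint. This is what separates the two
    endpoints of an edge in the counting lemma. *)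
Lemma edges_incident e f : e \in edges -> f \in edges -> f != e ->
  incident f e.2 -> ~~ incident f e.1.
Proof.
case: e f => [a b] [c d]; rewrite !inE /incident /= => /andP[ab _] /andP[cd _].
rewrite xpair_eqE => nfe h; apply/negP => h'; move: nfe ab cd h h'.
rewrite -!val_eqE /=; lia.
Qed.

(** An edge at [v] is determined by its other endpoint, a neighbour of [v]. *)
Lemma card_incident v : (#|[set e in edges | incident e v]| <= max_degree H)%N.
Proof.
apply: leq_trans (@leq_bigmax _ _ v).
pose f (e : 'I_k * 'I_k) := if e.1 == v then e.2 else e.1.
rewrite -(card_in_imset (f := f)); last first.
  move=> [a b] [c d]; rewrite !inE /f /incident /= => /andP[/andP[ab _] hi] /andP[/andP[cd _] hj].
  move: hi hj; have [av|av] := eqVneq a v; have [cv|cv] := eqVneq c v => //=.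
  - by move=> _ _ ->; rewrite av cv.
  - by move=> _ /eqP dv bc; move: ab cd; rewrite av dv bc; lia.
  - by move=> /eqP bv _ ad; move: ab cd; rewrite bv cv ad; lia.
  - by move=> /eqP -> /eqP -> ->.
apply: subset_leq_card; apply/fintype.subsetP => j /imsetP[[a b]].
rewrite !inE /f /incident /= => /andP[/andP[ab hab] hv] ->.
by move: hv hab; case: eqP => [-> //|_ /= /eqP ->]; rewrite sgraph_sym.
Qed.

Lemma max_degree_le : (max_degree H <= num_edges H)%N.
Proof.
apply/bigmax_leqP => v _; rewrite num_edgesE.
pose f (j : 'I_k) := if (v < j)%N then (v, j) else (j, v).
rewrite -(card_in_imset (f := f)); last first.
  move=> i j _ _; rewrite /f; case: ifP; case: ifP => // h1 h2 [] //.
  - by move=> e1 e2; rewrite e2.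
  - by move=> e1 e2; rewrite e1.
apply: subset_leq_card; apply/fintype.subsetP => j /imsetP[i].
rewrite !inE /f => hvi ->; have [h|h] /= := ltnP v i; first by rewrite h.
rewrite sgraph_sym hvi andbT ltn_neqAle h andbT.
by apply/eqP => /val_inj e; move: hvi; rewrite e sgraph_irr.
Qed.

Lemma max_degree_gt0 : (0 < num_edges H)%N -> (0 < max_degree H)%N.
Proof.
rewrite num_edgesE => /card_gt0P[e he]; apply: leq_trans (card_incident e.1).
by apply/card_gt0P; exists e; rewrite inE he /incident eqxx.
Qed.

(** The edges and their reversals are disjoint sets of off-diagonal pairs. The bound relates [m] to
    [k] in the comparison of exponents. *)
Lemma num_edges_le : (2 * num_edges H <= k * k.-1)%N.
Proof.
rewrite num_edgesE mul2n -addnn.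
pose sw (e : 'I_k * 'I_k) := (e.2, e.1).
have swI : injective sw by move=> [a b] [c d] [-> ->].
rewrite -{2}(card_imset _ swI) -cardsUI.
have -> : edges :&: [set sw x | x in edges] = finset.set0.
  apply/setP => e; rewrite !inE; apply/negP => /andP[/andP[h _] /imsetP[f]].
  by rewrite inE => /andP[h' _] ef; move: h; rewrite ef /= ltnNge ltnW.
rewrite cards0 addn0.
apply: (@leq_trans #|[set e : 'I_k * 'I_k | e.1 != e.2]|).
  apply: subset_leq_card; apply/fintype.subsetP => e; rewrite !inE => /orP[/andP[h _]|/imsetP[f]].
    by rewrite neq_ltn h.
  by rewrite inE => /andP[h _] ->; rewrite /= neq_ltn h orbT.
pose d (i : 'I_k) := (i, i).
have -> : [set e : 'I_k * 'I_k | e.1 != e.2] = ~: [set d i | i in 'I_k].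
  apply/setP => -[a b]; rewrite !inE /=; congr negb; apply/eqP/imsetP => [->|[i _ [-> ->]] //].
  by exists b.
rewrite cardsCs finset.setCK card_prod card_ord card_imset ?card_ord; last by move=> i j [].
by case: k => // n; rewrite mulnS addKn mulnC.
Qed.

End Edges.

(** * Hölder bound and counting lemma for densities *)

Section Density.
Variables (R : realType) (k : nat) (H : sgraph k) (N : nat).
Implicit Types (x y : 'M[R]_N) (q : {ffun 'I_k -> 'I_N}).

Notation m := (num_edges H).
Notation E := (edges H).

Lemma array_densityE x : array_density H x =
  (N%:R ^+ k)^-1 * \sum_(q : {ffun 'I_k -> 'I_N}) \prod_(e in E) x (q e.1) (q e.2).
Proof.
congr (_ * _); apply: eq_bigr => q _; rewrite pair_big_dep /=.
by apply: eq_bigl => e; rewrite inE.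
Qed.

Definition adj_mx (G : sgraph N) : 'M[R]_N := \matrix_(i, j) (G i j)%:R.

Lemma prod_adj_mx (G : sgraph N) q (A : {set 'I_k * 'I_k}) :
  \prod_(e in A) adj_mx G (q e.1) (q e.2) = [forall e in A, G (q e.1) (q e.2)]%:R.
Proof.
case: (boolP [forall e in A, _]) => [/forall_inP h|].
  by rewrite big1 // => e eA; rewrite mxE h.
rewrite negb_forall_in => /exists_inP[e eA he].
by rewrite (bigD1 e) //= mxE (negbTE he) mul0r.
Qed.

Lemma hom_densityE (G : sgraph N) : hom_density R H G = array_density H (adj_mx G).
Proof.
rewrite /hom_density array_densityE mulrC; congr (_ * _).
rewrite /Defs.hom -sum1_card natr_sum big_mkcond /=; apply: eq_bigr => q _.
rewrite prod_adj_mx -mulrb inE; congr (_ %:R); congr nat_of_bool.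
apply/forallP/forall_inP => [h e|h i].
  by rewrite inE => /andP[_ He]; move: (h e.1) => /forallP/(_ e.2)/implyP; apply.
apply/forallP => j; apply/implyP => Hij.
have [ij|ji|/val_inj ij] := ltngtP i j.
- by apply: (h (i, j)); rewrite inE ij.
- by rewrite sgraph_sym; apply: (h (j, i)); rewrite inE ji sgraph_sym.
- by move: Hij; rewrite ij sgraph_irr.
Qed.

Hypothesis N0 : (0 < N)%N.

(** Write each factor as the [D]-th root of its [D]-th power; every vertex lies in at most [D]
    edges, so [finner] applies, and each of the [m] edges yields the same mean. *)
Lemma density_finner x : (0 < m)%N -> (forall i j, 0 <= x i j) ->
  array_density H x <= ((N%:R ^+ 2)^-1 * \sum_i \sum_j x i j ^+ max_degree H)
     `^ (m%:R / (max_degree H)%:R).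
Proof.
move=> m0 x0; set D := max_degree H.
have D0 : (0 < D)%N by exact: max_degree_gt0.
pose g (e : 'I_k * 'I_k) q := x (q e.1) (q e.2) ^+ D.
have -> : array_density H x = (N%:R ^+ k)^-1 *
   \sum_(q : {ffun 'I_k -> 'I_N}) \prod_(e in E) g e q `^ D%:R^-1.
  rewrite array_densityE; congr (_ * _); apply: eq_bigr => q _; apply: eq_bigr => e _.
  by rewrite /g -powR_mulrn // -powRrM divff ?pnatr_eq0 -?lt0n // powRr1.
apply: le_trans (finner (D := D) (dep := @incident k) N0 D0 _ _ _) _.
- by move=> v; exact: card_incident.
- by move=> e q; rewrite exprn_ge0.
- move=> e v; rewrite negb_or => /andP[h1 h2] q i.
  by rewrite /g !upd_neq.
rewrite (eq_bigr (fun=> ((N%:R ^+ 2)^-1 * \sum_i \sum_j x i j ^+ D) `^ D%:R^-1)); last first.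
  by move=> e eE; rewrite /g (marginal N0 (fun i j => x i j ^+ D) (edges_neq eE)).
by rewrite prodr_const -num_edgesE -powR_mulrn ?powR_ge0 // -powRrM [D%:R^-1 * _]mulrC.
Qed.

Lemma sum_le_pos (f c : 'I_N -> R) : (forall i, 0 <= f i <= 1) ->
  \sum_i f i * c i <= \sum_(i in [set i | 0 < c i]) c i.
Proof.
move=> hf; rewrite [leRHS]big_mkcond /=; apply: ler_sum => i _.
have /andP[f0 f1] := hf i; rewrite inE; case: ltrP => hc.
  by rewrite ler_piMl // ltW.
by rewrite mulr_ge0_le0.
Qed.

(** A bilinear form on a cube is largest at a vertex, that is, at a pair of indicator functions. *)
Lemma bilinear_cut (w : 'I_N -> 'I_N -> R) (c : R) (f g : 'I_N -> R) :
  (forall S T : {set 'I_N}, \sum_(i in S) \sum_(j in T) w i j <= c) ->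
  (forall i, 0 <= f i <= 1) -> (forall i, 0 <= g i <= 1) ->
  \sum_i \sum_j w i j * f i * g j <= c.
Proof.
move=> hw hf hg.
have -> : \sum_i \sum_j w i j * f i * g j = \sum_i f i * \sum_j g j * w i j.
  by apply: eq_bigr => i _; rewrite mulr_sumr; apply: eq_bigr => j _; ring.
apply: le_trans (sum_le_pos _ hf) _; set S := [set i | _].
rewrite exchange_big /=.
rewrite (eq_bigr (fun j => g j * \sum_(i in S) w i j)) => [|j _]; last by rewrite mulr_sumr.
by apply: le_trans (sum_le_pos _ hg) _; rewrite exchange_big.
Qed.

(** Resample [q a] and [q b] with the rest frozen: [f] then varies with [q a] only and [g] with
    [q b] only. *)
Lemma edge_cut (w : 'I_N -> 'I_N -> R) (c : R) (a b : 'I_k)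
    (f g : {ffun 'I_k -> 'I_N} -> R) : a != b ->
  (forall S T : {set 'I_N}, \sum_(i in S) \sum_(j in T) w i j <= c) ->
  indep f b -> indep g a ->
  (forall q, 0 <= f q <= 1) -> (forall q, 0 <= g q <= 1) ->
  (N%:R ^+ k)^-1 * (\sum_(q : {ffun 'I_k -> 'I_N}) w (q a) (q b) * f q * g q)
    <= (N%:R ^+ 2)^-1 * c.
Proof.
move=> nab hw fb ga hf hg; rewrite -[leRHS](@avg_const R k N) //.
rewrite ler_wpM2l ?invr_ge0 ?exprn_ge0 ?ler0n //.
rewrite -(sum_avgv N0 _ b) -(sum_avgv N0 _ a); apply: ler_sum => q _.
rewrite /avgv -mulr_sumr mulrA -invfM -expr2 ler_wpM2l ?invr_ge0 ?exprn_ge0 ?ler0n //.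
apply: le_trans (bilinear_cut (f := fun i => f (upd q a i)) (g := fun j => g (upd q b j)) hw _ _) => //.
rewrite le_eqVlt; apply/orP; left; apply/eqP.
apply: eq_bigr => i _; apply: eq_bigr => j _.
by rewrite upd_neq // !updE fb updC // ga.
Qed.

Lemma prod_unit_itv (I : finType) (P : pred I) (F : I -> R) :
  (forall i, 0 <= F i <= 1) -> 0 <= \prod_(i | P i) F i <= 1.
Proof.
move=> hF; rewrite prodr_ge0 => [|i _]; last by case/andP: (hF i).
by rewrite Num.Theory.prodr_ile1.
Qed.

(* Replace the factors one edge at a time; with all other vertices frozen, the
   remaining factors split as a function of one endpoint times a function of the
   other, so the cut bound applies. *)
Lemma density_le_cut x y (d : R) :
  (forall i j, 0 <= x i j <= 1) -> (forall i j, 0 <= y i j <= 1) ->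
  (forall S T : {set 'I_N}, \sum_(i in S) \sum_(j in T) (y i j - x i j) <= d * N%:R ^+ 2) ->
  array_density H y <= array_density H x + m%:R * d.
Proof.
move=> hx hy hw; rewrite -lerBlDl !array_densityE -mulrBr -sumrB.
pose P (z : 'M[R]_N) (A : {set 'I_k * 'I_k}) q : R := \prod_(e in A) z (q e.1) (q e.2).
(* [A] holds the edges whose factor has already become [y], [B] those still to be replaced. *)
suff main : forall n (A B : {set 'I_k * 'I_k}), #|B| = n -> A :|: B \subset E ->
    [disjoint A & B] ->
    (N%:R ^+ k)^-1 * (\sum_(q : {ffun 'I_k -> 'I_N}) P y A q * (P y B q - P x B q)) <= n%:R * d.
  rewrite num_edgesE; have := main #|E| finset.set0 E erefl.
  rewrite finset.set0U => /(_ (fintype.subxx _)).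
  rewrite -setI_eq0 finset.set0I eqxx => /(_ isT).
  by under eq_bigr => q _ do rewrite {1}/P big_set0 mul1r.
elim=> [|n IH] A B cB sub dis.
  rewrite big1 ?mulr0 ?mul0r // => q _.
  by move/eqP: cB; rewrite cards_eq0 => /eqP ->; rewrite /P !big_set0 subrr mulr0.
have /card_gt0P[e eB] : (0 < #|B|)%N by rewrite cB.
have eE : e \in E by apply: (fintype.subsetP sub); rewrite inE eB orbT.
have eA : e \notin A.
  by apply/negP => eA; have := disjointFr dis eA; rewrite eB.
pose B' := B :\ e; pose A' := e |: A.
have cB' : #|B'| = n by apply/eqP; rewrite -eqSS -cB (cardsD1 e B) eB.
have sub' : A' :|: B' \subset E.
  apply/fintype.subsetP => f; rewrite !inE => /orP[/orP[/eqP ->|fA]|/andP[_ fB]].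
  - by move: eE; rewrite inE.
  - by have := fintype.subsetP sub f; rewrite !inE fA; apply.
  - by have := fintype.subsetP sub f; rewrite !inE fB orbT; apply.
have dis' : [disjoint A' & B'].
  rewrite finset.disjoints_subset; apply/fintype.subsetP => f; rewrite !inE => /orP[/eqP ->|fA].
    by rewrite eqxx.
  by rewrite (disjointFr dis fA) andbF.
have PB z q : P z B q = z (q e.1) (q e.2) * P z B' q by rewrite /P (big_setD1 e).
have PA z q : P z A' q = z (q e.1) (q e.2) * P z A q by rewrite /P big_setU1.
have -> : \sum_q P y A q * (P y B q - P x B q) =
    \sum_q P y A' q * (P y B' q - P x B' q) +
    \sum_(q : {ffun 'I_k -> 'I_N}) (y (q e.1) (q e.2) - x (q e.1) (q e.2)) * (P y A q * P x B' q).
  by rewrite -big_split /=; apply: eq_bigr => q _; rewrite !PB PA; ring.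
rewrite mulrDr -natr1 mulrDl mul1r; apply: lerD; first exact: IH.
(* The factors avoiding [e.2] go into [F]. Those meeting [e.2] go into [G]; by simplicity they avoid
   [e.1]. *)
pose T2 (f : 'I_k * 'I_k) := incident f e.2.
pose F (q : {ffun 'I_k -> 'I_N}) := (\prod_(f in A | ~~ T2 f) y (q f.1) (q f.2)) *
            \prod_(f in B' | ~~ T2 f) x (q f.1) (q f.2).
pose G (q : {ffun 'I_k -> 'I_N}) := (\prod_(f in A | T2 f) y (q f.1) (q f.2)) *
            \prod_(f in B' | T2 f) x (q f.1) (q f.2).
have hF q : 0 <= F q <= 1.
  have /andP[h1 h2] := prod_unit_itv (fun f => (f \in A) && ~~ T2 f) (fun f => hy (q f.1) (q f.2)).
  have /andP[h3 h4] := prod_unit_itv (fun f => (f \in B') && ~~ T2 f) (fun f => hx (q f.1) (q f.2)).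
  by rewrite mulr_ge0 // mulr_ile1.
have hG q : 0 <= G q <= 1.
  have /andP[h1 h2] := prod_unit_itv (fun f => (f \in A) && T2 f) (fun f => hy (q f.1) (q f.2)).
  have /andP[h3 h4] := prod_unit_itv (fun f => (f \in B') && T2 f) (fun f => hx (q f.1) (q f.2)).
  by rewrite mulr_ge0 // mulr_ile1.
have iF : indep F e.2.
  move=> q i; rewrite /F; congr (_ * _); apply: eq_bigr => f /andP[_];
    by rewrite negb_or => /andP[h1 h2]; rewrite !upd_neq.
have nA f : f \in A :|: B' -> T2 f -> (f.1 != e.1) && (f.2 != e.1).
  move=> fA h; rewrite -negb_or; apply: (edges_incident eE) => //.
    apply: (fintype.subsetP sub); move: fA; rewrite !inE.
    by case/orP=> [->|/andP[_ ->]]; rewrite ?orbT.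
  by apply: contraTneq fA => ->; rewrite !inE eqxx (negbTE eA).
have iG : indep G e.1.
  move=> q i; rewrite /G; congr (_ * _); apply: eq_bigr => f /andP[fA /nA];
    by rewrite inE fA ?orbT => /(_ isT)/andP[h1 h2]; rewrite !upd_neq.
have := edge_cut (edges_neq eE) hw iF iG hF hG.
rewrite mulrCA mulVf ?mulr1 ?expf_neq0 ?pnatr_eq0 -?lt0n //; apply: le_trans.
rewrite le_eqVlt; apply/orP; left; apply/eqP; congr (_ * _).
apply: eq_bigr => q _; 
have PT z C : P z C q = (\prod_(f in C | T2 f) z (q f.1) (q f.2)) *
    \prod_(f in C | ~~ T2 f) z (q f.1) (q f.2) by rewrite /P (bigID T2).
by rewrite !PT /F /G; ring.
Qed.

End Density.

(** * Moving an array towards the complete graph *)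

Section Mix.
Variables (R : realType) (k : nat) (H : sgraph k) (N : nat).
Hypothesis N0 : (0 < N)%N.
Implicit Types (x y : 'M[R]_N) (q : {ffun 'I_k -> 'I_N}).

Notation m := (num_edges H).
Notation E := (edges H).

Lemma density_mono x y : (forall i j, 0 <= x i j <= y i j) ->
  array_density H x <= array_density H y.
Proof.
move=> h; rewrite !array_densityE ler_wpM2l ?invr_ge0 ?exprn_ge0 ?ler0n //.
by apply: ler_sum => q _; apply: ler_prod.
Qed.

Lemma density_ge0 x : (forall i j, 0 <= x i j) -> 0 <= array_density H x.
Proof.
move=> h; rewrite array_densityE mulr_ge0 ?invr_ge0 ?exprn_ge0 ?ler0n //.
by apply: sumr_ge0 => q _; apply: prodr_ge0.
Qed.

Lemma density_le_mean x : (0 < m)%N -> (forall i j, 0 <= x i j <= 1) ->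
  array_density H x <= (N%:R ^+ 2)^-1 * \sum_i \sum_j x i j.
Proof.
rewrite num_edgesE => /card_gt0P[e eE] hx.
rewrite -(marginal N0 (fun i j => x i j) (edges_neq eE)) array_densityE.
rewrite ler_wpM2l ?invr_ge0 ?exprn_ge0 ?ler0n //; apply: ler_sum => q _.
rewrite (bigD1 e) //=; have /andP[h _] := hx (q e.1) (q e.2).
rewrite ler_piMr // Num.Theory.prodr_ile1 //.
Qed.

Lemma density_const1 : array_density H (const_mx 1 : 'M[R]_N) = 1.
Proof.
rewrite array_densityE -[RHS](@avg_const R k N) //; congr (_ * _).
by apply: eq_bigr => q _; rewrite big1 // => e _; rewrite mxE.
Qed.

(** The largest element of [arrays]: the constant 1 is excluded by the zero diagonal. *)
Definition complete_mx : 'M[R]_N := \matrix_(i, j) (i != j)%:R.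

Lemma complete_mx_itv i j : 0 <= complete_mx i j <= 1.
Proof. by rewrite mxE; case: (_ != _); rewrite ?lexx ?ler01. Qed.

Lemma complete_mx_arrays : arrays complete_mx.
Proof.
split=> [i j|i|i j]; [exact: complete_mx_itv|by rewrite mxE eqxx|by rewrite !mxE eq_sym].
Qed.

Lemma le_complete_mx x i j : arrays x -> 0 <= x i j <= complete_mx i j.
Proof.
case=> hx xd _; rewrite mxE; have [<-|_] := eqVneq i j; first by rewrite xd lexx.
exact: hx.
Qed.

Lemma density_le_complete_mx x : arrays x -> array_density H x <= array_density H complete_mx.
Proof. by move=> hx; apply: density_mono => i j; exact: le_complete_mx. Qed.

(** Compare with the constant array 1 by [density_le_cut]: only diagonal entries differ, at most [N]
    of them in any rectangle. *)
Lemma density_complete_mx_ge : 1 - m%:R / N%:R <= array_density H complete_mx.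
Proof.
have NR : 0 < N%:R :> R by rewrite ltr0n.
rewrite lerBlDr -[leLHS]density_const1; apply: density_le_cut => //; first exact: complete_mx_itv.
- by move=> i j; rewrite mxE ler01 lexx.
move=> S T; rewrite expr2 mulKf ?gt_eqF //.
apply: (@le_trans _ _ (\sum_(i in S) \sum_(j < N) (i == j)%:R)).
  apply: ler_sum => i _; rewrite [leLHS]big_mkcond /=; apply: ler_sum => j _.
  rewrite !mxE; case: ifP => _; first by case: eqP => _ /=; rewrite ?subr0 ?subrr.
  by rewrite ler0n.
apply: (@le_trans _ _ (\sum_(i in S) 1)).
  apply: ler_sum => i _; rewrite (bigD1 i) //= eqxx big1 ?addr0 // => j.
  by rewrite eq_sym => /negbTE ->.
rewrite sumr_const ler_nat -[leqRHS]card_ord; exact: max_card.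
Qed.

(** Replace each factor by 1 independently with probability [t]. The right-hand side is the mean of
    the product, which is 1 when all factors are replaced, an event of probability [t ^+ size s],
    and otherwise at least the original product. *)
Lemma prod_mix (I : Type) (s : seq I) (a : I -> R) (t : R) :
  0 <= t <= 1 -> (forall i, 0 <= a i <= 1) ->
  \prod_(i <- s) a i + t ^+ size s * (1 - \prod_(i <- s) a i) <=
  \prod_(i <- s) ((1 - t) * a i + t).
Proof.
move=> /andP[t0 t1] ha; elim: s => [|i s IH].
  by rewrite !big_nil subrr mulr0 addr0.
rewrite !big_cons /= exprS; have /andP[a0 a1] := ha i.
have : 0 <= \prod_(j <- s) a j <= 1.
  by rewrite prodr_ge0 ?Num.Theory.prodr_ile1 // => j _; case/andP: (ha j).
move: IH; set P := \prod_(j <- s) a j; set Q := \prod_(j <- s) _.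
set e := t ^+ size s => IH /andP[P0 P1].
have e0 : 0 <= e by exact: exprn_ge0.
have e1 : e <= 1 by exact: exprn_ile1.
have h : ((1 - t) * a i + t) * (P + e * (1 - P)) <= ((1 - t) * a i + t) * Q.
  by apply: ler_wpM2l => //; rewrite addr_ge0 // mulr_ge0 // subr_ge0.
apply: le_trans h; rewrite -subr_ge0.
have -> : ((1 - t) * a i + t) * (P + e * (1 - P)) - (a i * P + t * e * (1 - a i * P)) =
   t * (1 - e) * ((1 - a i) * P) + e * (1 - t) * (a i * (1 - P)) by ring.
by rewrite addr_ge0 // !mulr_ge0 // subr_ge0.
Qed.

Definition mix x t : 'M[R]_N := \matrix_(i, j) ((1 - t) * x i j + t * complete_mx i j).

Lemma mix_arrays x t : 0 <= t <= 1 -> arrays x -> arrays (mix x t).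
Proof.
move=> /andP[t0 t1] hx; have [xi xd xs] := hx; split=> [i j|i|i j]; rewrite !mxE.
- have /andP[a0 a1] := xi i j.
  case: (_ != _); rewrite /= ?mulr1 ?mulr0 ?addr0.
    by apply/andP; split; nra.
  by apply/andP; split; nra.
- by rewrite eqxx xd !mulr0 addr0.
- by rewrite xs eq_sym.
Qed.

(** The deficit from the complete graph shrinks by the factor [1 - t ^+ m]; apply [prod_mix] to each
    map. *)
Lemma density_mix x t : 0 <= t <= 1 -> arrays x ->
  array_density H complete_mx - array_density H (mix x t) <=
  (1 - t ^+ m) * (array_density H complete_mx - array_density H x).
Proof.
move=> ht hx; rewrite lerBlDr -lerBlDl.
have -> : array_density H complete_mx - (1 - t ^+ m) * (array_density H complete_mx - array_density H x) =
  array_density H x + t ^+ m * (array_density H complete_mx - array_density H x) by ring.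
rewrite !array_densityE -mulrBr mulrCA -mulrDr ler_wpM2l ?invr_ge0 ?exprn_ge0 ?ler0n //.
rewrite -sumrB mulr_sumr -big_split /=; apply: ler_sum => q _.
have [xi xd xs] := hx.
(* A map that collapses an edge contributes 0 to all three densities, because of the zero
   diagonals. *)
have [/exists_inP[e eE /eqP he]|] := boolP [exists e in E, q e.1 == q e.2].
  by rewrite !(bigD1 e eE) /= he !mxE eqxx xd !mulr0 !mul0r subrr !mulr0 !addr0 mul0r.
rewrite negb_exists_in => /forall_inP prop.
rewrite [X in _ * (X - _)]big1 => [|e eE]; last by rewrite mxE prop.
rewrite [leRHS](eq_bigr (fun e => (1 - t) * x (q e.1) (q e.2) + t)) => [|e eE]; last first.
  by rewrite !mxE prop // mulr1.
rewrite -!big_enum num_edgesE cardE.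
exact: (prod_mix _ ht (fun e => xi (q e.1) (q e.2))).
Qed.

End Mix.

(** * Random graphs with independent edges *)

Section ProductMeasure.
Variables (R : realType) (N : nat).
Implicit Types (x : 'M[R]_N) (G : sgraph N) (e f : 'I_N * 'I_N).

Definition up e := (e.1 < e.2)%N.

(** The law of the random graph [G_x] with independent edges. *)
Definition gnpx x G : R := \prod_(e | up e) (if G e.1 e.2 then x e.1 e.2 else 1 - x e.1 e.2).

Lemma gnpE p G : gnp p G = gnpx (const_mx p) G.
Proof. by rewrite /gnp pair_big_dep /=; apply: eq_bigr => e _; rewrite mxE. Qed.

Definition graph_of_fun (f : {ffun 'I_N * 'I_N -> bool}) : 'M[bool]_N :=
  \matrix_(i, j) ((i != j) && (f (i, j) || f (j, i))).

Lemma graph_of_fun_sgraph (f : {ffun 'I_N * 'I_N -> bool}) : is_sgraph (graph_of_fun f).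
Proof.
apply/andP; split; first by apply/forallP => i; rewrite mxE eqxx.
apply/forallP => i; apply/forallP => j; by rewrite !mxE orbC [j == i]eq_sym.
Qed.

(** Graphs correspond to boolean functions supported on the increasing pairs, with [graph_of_fun] as
    inverse; then distribute the product over the sums. *)
Lemma sum_graph_prod (phi : 'I_N * 'I_N -> bool -> R) :
  \sum_(G : sgraph N) \prod_(e | up e) phi e (G e.1 e.2) =
  \prod_(e | up e) (phi e true + phi e false).
Proof.
transitivity (\prod_(e | up e) \sum_(b : bool) phi e b); last first.
  by apply: eq_bigr => e _; rewrite big_bool.
rewrite (big_distr_big_dep false up (fun _ _ => true)) /=.
pose h G := [ffun e : 'I_N * 'I_N => up e && G e.1 e.2].
rewrite (reindex_onto h (fun f : {ffun 'I_N * 'I_N -> bool} => SGraph (graph_of_fun_sgraph f))) /=; last first.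
  move=> f /pfamilyP[/fintype.subsetP fs _]; apply/ffunP => e; rewrite ffunE /= mxE.
  case: e => i j /=; rewrite /up /=; case: ltnP => ij /=; last first.
    by apply/esym/negbTE/negP => fe; have := fs (i, j); rewrite inE fe => /(_ isT); rewrite unfold_in /up /= ltnNge ij.
  rewrite neq_ltn ij /=; suff -> : f (j, i) = false by rewrite orbF.
  apply/negbTE/negP => fe; have := fs (j, i); rewrite inE fe => /(_ isT).
  by rewrite unfold_in /up /= ltnNge ltnW.
apply: eq_big => [G|G _].
  apply/esym/andP; split.
    apply/pfamilyP; split=> //; apply/fintype.subsetP => e.
    by rewrite inE ffunE; case: (boolP (up e)).
  apply/eqP/val_inj/matrixP => i j; rewrite /= mxE !ffunE /up /=.
  case: (ltngtP i j) => [ij|ji|/val_inj ->]; last by rewrite eqxx sgraph_irr.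
    by rewrite neq_ltn ij orbF.
  by rewrite neq_ltn ji orbT /= sgraph_sym.
by apply: eq_bigr => e ue; rewrite ffunE ue.
Qed.

Lemma E_prod x (phi : 'I_N * 'I_N -> bool -> R) :
  \sum_G gnpx x G * \prod_(e | up e) phi e (G e.1 e.2) =
  \prod_(e | up e) (x e.1 e.2 * phi e true + (1 - x e.1 e.2) * phi e false).
Proof.
rewrite -(sum_graph_prod (fun e b => (if b then x e.1 e.2 else 1 - x e.1 e.2) * phi e b)).
by apply: eq_bigr => G _; rewrite -big_split.
Qed.

Lemma E_one x : \sum_G gnpx x G = 1.
Proof.
have := E_prod x (fun _ _ => 1); rewrite [RHS]big1 => [<-|e _]; last by rewrite !mulr1 addrC subrK.
by apply: eq_bigr => G _; rewrite big1 ?mulr1.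
Qed.

Lemma gnpx_ge0 x G : (forall i j, 0 <= x i j <= 1) -> 0 <= gnpx x G.
Proof.
move=> hx; apply: prodr_ge0 => e _; have /andP[x0 x1] := hx e.1 e.2.
by case: ifP; rewrite ?subr_ge0.
Qed.

Definition has_edges (F : {set 'I_N * 'I_N}) G := [forall e in F, G e.1 e.2].

Lemma E_has_edges x (F : {set 'I_N * 'I_N}) : (forall e, e \in F -> up e) ->
  \sum_G gnpx x G * (has_edges F G)%:R = \prod_(e in F) x e.1 e.2.
Proof.
move=> hF; have := E_prod x (fun e b => if e \in F then b%:R else 1).
rewrite [RHS](bigID (mem F)) /= [X in _ = _ * X]big1 => [|e /andP[_ /negbTE ->]]; last first.
  by rewrite !mulr1 addrC subrK.
rewrite mulr1 => h; transitivity (\prod_(i | up i && (i \in F))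
         (x i.1 i.2 * (if i \in F then 1 else 1) +
          (1 - x i.1 i.2) * (if i \in F then 0 else 1))); last first.
  apply: eq_big => [e|e /andP[_ ->]]; last by rewrite mulr1 mulr0 addr0.
  by case: (boolP (e \in F)) => [/hF ->|]; rewrite ?andbF.
rewrite -h; apply: eq_bigr => G _; congr (_ * _).
case: (boolP (has_edges F G)) => [/forall_inP hi|].
  by rewrite big1 // => e _; case: ifP => // /hi ->.
rewrite negb_forall_in => /exists_inP[e eF hG].
by rewrite (bigD1 e) ?hF //= eF (negbTE hG) mul0r.
Qed.

Lemma E_coord x e (xi : bool -> R) : up e ->
  \sum_G gnpx x G * xi (G e.1 e.2) = x e.1 e.2 * xi true + (1 - x e.1 e.2) * xi false.
Proof.
move=> ue; have := E_prod x (fun f b => if f == e then xi b else 1).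
rewrite [RHS](bigD1 e) //= eqxx [X in _ = _ * X]big1 ?mulr1 => [<-|f /andP[_ /negbTE ->]]; last first.
  by rewrite !mulr1 addrC subrK.
apply: eq_bigr => G _; rewrite (bigD1 e) //= eqxx big1 ?mulr1 //.
by move=> f /andP[_ /negbTE ->].
Qed.

Lemma E_coord2 x e f (xi eta : bool -> R) : up e -> up f -> e != f ->
  \sum_G gnpx x G * (xi (G e.1 e.2) * eta (G f.1 f.2)) =
  (x e.1 e.2 * xi true + (1 - x e.1 e.2) * xi false) *
  (x f.1 f.2 * eta true + (1 - x f.1 f.2) * eta false).
Proof.
move=> ue uf nef.
have := E_prod x (fun g b => if g == e then xi b else if g == f then eta b else 1).
rewrite [RHS](bigD1 e) //= eqxx (bigD1 f) /=; last by rewrite uf eq_sym.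
rewrite eq_sym (negbTE nef) eqxx [X in _ = _ * (_ * X)]big1 ?mulr1 => [<-|g /andP[/andP[_ /negbTE ->] /negbTE ->]]; last first.
  by rewrite !mulr1 addrC subrK.
apply: eq_bigr => G _; rewrite (bigD1 e) //= eqxx (bigD1 f) /=; last by rewrite uf eq_sym.
rewrite eq_sym (negbTE nef) eqxx big1 ?mulr1 //.
by move=> g /andP[/andP[_ /negbTE ->] /negbTE ->].
Qed.

(** The summands are independent and centred, so the cross terms vanish. *)
Lemma E_sum_sqr x (xi : 'I_N * 'I_N -> bool -> R) :
  (forall e, up e -> x e.1 e.2 * xi e true + (1 - x e.1 e.2) * xi e false = 0) ->
  \sum_G gnpx x G * (\sum_(e | up e) xi e (G e.1 e.2)) ^+ 2 =
  \sum_(e | up e) (x e.1 e.2 * xi e true ^+ 2 + (1 - x e.1 e.2) * xi e false ^+ 2).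
Proof.
move=> h0.
have -> : \sum_G gnpx x G * (\sum_(e | up e) xi e (G e.1 e.2)) ^+ 2 =
  \sum_(e | up e) \sum_(f | up f) \sum_G gnpx x G * (xi e (G e.1 e.2) * xi f (G f.1 f.2)).
  under [RHS]eq_bigr => e _ do rewrite exchange_big.
  rewrite [RHS]exchange_big /=; apply: eq_bigr => G _.
  rewrite expr2 mulr_suml mulr_sumr; apply: eq_bigr => e _.
  by rewrite mulr_sumr mulr_sumr.
apply: eq_bigr => e ue; rewrite (bigD1 e) //= [X in _ + X]big1 ?addr0.
  by have := E_coord x (fun b => xi e b * xi e b) ue; rewrite /= !expr2.
move=> f /andP[uf nfe]; rewrite E_coord2 // 1?eq_sym // h0 // mul0r.
by [].
Qed.

End ProductMeasure.

(** * Copies of the fixed graph and moments of their density *)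

Section Moments.
Variables (R : realType) (k : nat) (H : sgraph k) (N : nat).
Implicit Types (x : 'M[R]_N) (q : {ffun 'I_k -> 'I_N}) (G : sgraph N) (F : {set 'I_N * 'I_N}).

Notation m := (num_edges H).
Notation E := (edges H).

(** The weights of [gnpx] run over increasing pairs, so the images of edges are put in that
    order. *)
Definition ordp (e : 'I_N * 'I_N) := if (e.1 < e.2)%N then e else (e.2, e.1).

Lemma up_ordp e : e.1 != e.2 -> up (ordp e).
Proof.
rewrite neq_ltn /up /ordp => /orP[h|h]; first by rewrite h.
by have -> : (e.1 < e.2)%N = false by apply/negbTE; rewrite -leqNgt ltnW.
Qed.

Lemma ordp_eq e f : ordp e = ordp f -> e = f \/ e = (f.2, f.1).
Proof.
case: e f => [a b] [c d]; rewrite /ordp /=.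
by case: ifP => _; case: ifP => _ [-> ->]; [left|right|right|left].
Qed.

(** A set: edges of [H] with the same image count once, as they do in the probability that the copy
    is present. *)
Definition edge_img q : {set 'I_N * 'I_N} := [set ordp (q e.1, q e.2) | e in E].

Definition loopless q := [forall e in E, q e.1 != q e.2].

Lemma edge_img_up q s : loopless q -> s \in edge_img q -> up s.
Proof. by move=> /forall_inP h /imsetP[e eE ->]; apply: up_ordp; exact: h. Qed.

Lemma card_edge_img q : (#|edge_img q| <= m)%N.
Proof. by rewrite num_edgesE; exact: leq_imset_card. Qed.

Lemma adj_ordp G i j : G (ordp (i, j)).1 (ordp (i, j)).2 = G i j.
Proof. by rewrite /ordp /=; case: ifP => //= _; rewrite sgraph_sym. Qed.

Lemma forall_adj q G :
  [forall e in E, G (q e.1) (q e.2)] = loopless q && has_edges (edge_img q) G.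
Proof.
apply/forall_inP/andP => [h|[_ /forall_inP h] e eE]; last first.
  by rewrite -adj_ordp; apply: h; apply/imsetP; exists e.
split; first by apply/forall_inP => e eE; apply: contraTneq (h e eE) => ->; rewrite sgraph_irr.
by apply/forall_inP => s /imsetP[e eE ->]; rewrite adj_ordp h.
Qed.

Lemma density_adj_mx G : array_density H (adj_mx R G) =
  (N%:R ^+ k)^-1 * \sum_(q | loopless q) (has_edges (edge_img q) G)%:R.
Proof.
rewrite array_densityE [in RHS]big_mkcond; congr (_ * _); apply: eq_bigr => q _.
by rewrite prod_adj_mx forall_adj; case: ifP.
Qed.

Lemma prod_imset_ge (I J : finType) (h : I -> J) (A : {set I}) (g : J -> R) :
  (forall j, 0 <= g j <= 1) ->
  \prod_(i in A) g (h i) <= \prod_(j in [set h i | i in A]) g j.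
Proof.
move=> hg; rewrite (partition_big_imset h) /=; apply: ler_prod => j /imsetP[i iA ji].
have h1 (P : pred I) : 0 <= \prod_(i | P i) g (h i) <= 1.
  by rewrite prodr_ge0 ?Num.Theory.prodr_ile1 // => l _; case/andP: (hg (h l)).
rewrite (andP (h1 _)).1 /= (bigD1 i) /=; last by rewrite iA ji eqxx.
rewrite ji; have /andP[g0 _] := hg (h i).
by apply: ler_piMr => //; have /andP[] := h1 (fun l => [&& l \in A, h l == h i & l != i]); under [X in _ -> X <= _]eq_bigl do rewrite -andbA.
Qed.

(** Only an inequality: when a map gives several edges the same image, the density multiplies the
    entry repeatedly while the probability contains it once, and entries are at most 1. *)
Lemma E_density_ge x : arrays x ->
  array_density H x <= \sum_G gnpx x G * array_density H (adj_mx R G).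
Proof.
move=> [hx xd xs].
under eq_bigr => G _ do rewrite density_adj_mx mulrCA mulr_sumr.
rewrite -mulr_sumr exchange_big /= array_densityE ler_wpM2l ?invr_ge0 ?exprn_ge0 ?ler0n //.
rewrite [leRHS]big_mkcond /=; apply: ler_sum => q _; case: (boolP (loopless q)) => [pq|].
  rewrite E_has_edges => [|s]; last exact: edge_img_up.
  apply: le_trans (prod_imset_ge (fun e => ordp (q e.1, q e.2)) E (g := fun s => x s.1 s.2) _) => //.
  rewrite le_eqVlt; apply/orP; left; apply/eqP; apply: eq_bigr => e _.
  by rewrite /ordp /=; case: ifP => //= _; rewrite xs.
rewrite negb_forall_in => /exists_inP[e eE]; rewrite negbK => /eqP he.
by rewrite (bigD1 e) //= he xd mul0r.
Qed.

Lemma has_edges_setU F1 F2 G : has_edges (F1 :|: F2) G = has_edges F1 G && has_edges F2 G.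
Proof.
apply/forall_inP/andP => [h|[/forall_inP h1 /forall_inP h2] e].
  by split; apply/forall_inP => e eF; apply: h; rewrite inE eF ?orbT.
by rewrite inE => /orP[/h1|/h2].
Qed.

(* Expand one factor at a time: a copy of [H] sharing edges with the planted set
   [F] only pays for its new edges. *)
Lemma moment_bound (p b : R) (K : nat) : 0 <= p <= 1 -> 0 <= b ->
  (forall F, (#|F| <= K)%N -> (forall e, e \in F -> up e) ->
    (N%:R ^+ k)^-1 * (\sum_(q | loopless q) p ^+ #|edge_img q :\: F|) <= b) ->
  forall r F, (#|F| + r * m <= K)%N -> (forall e, e \in F -> up e) ->
  \sum_G gnp p G * ((has_edges F G)%:R * array_density H (adj_mx R G) ^+ r) <= p ^+ #|F| * b ^+ r.
Proof.
move=> /andP[p0 p1] b0 hb; elim=> [|r IH] F hF upF.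
  under eq_bigr => G _ do rewrite gnpE mulr1.
  rewrite E_has_edges // (eq_bigr (fun=> p)) => [|e _]; last by rewrite mxE.
  by rewrite prodr_const mulr1.
have -> : \sum_G gnp p G * ((has_edges F G)%:R * array_density H (adj_mx R G) ^+ r.+1) =
    (N%:R ^+ k)^-1 * \sum_(q | loopless q)
    \sum_G gnp p G * ((has_edges (F :|: edge_img q) G)%:R * array_density H (adj_mx R G) ^+ r).
  rewrite exchange_big mulr_sumr /=; apply: eq_bigr => G _.
  have -> : \sum_(q | loopless q) gnp p G *
      ((has_edges (F :|: edge_img q) G)%:R * array_density H (adj_mx R G) ^+ r) =
      gnp p G * ((has_edges F G)%:R * (\sum_(q | loopless q) (has_edges (edge_img q) G)%:R)
        * array_density H (adj_mx R G) ^+ r).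
    rewrite mulr_sumr mulr_suml mulr_sumr; apply: eq_bigr => q _.
    by rewrite has_edges_setU -mulnb natrM.
  rewrite exprS {1}density_adj_mx; ring.
apply: (@le_trans _ _ ((N%:R ^+ k)^-1 * \sum_(q | loopless q) p ^+ #|F| * p ^+ #|edge_img q :\: F| * b ^+ r)).
  rewrite ler_wpM2l ?invr_ge0 ?exprn_ge0 ?ler0n //; apply: ler_sum => q pq.
  have -> : p ^+ #|F| * p ^+ #|edge_img q :\: F| = p ^+ #|F :|: edge_img q|.
    rewrite -exprD; congr (_ ^+ _); rewrite -(cardsID F (F :|: edge_img q)).
    rewrite finset.setUK finset.setDUl finset.setDv finset.set0U //.
  apply: IH; last by move=> e; rewrite inE => /orP[/upF|/(edge_img_up pq)].
  apply: leq_trans hF; rewrite mulSn addnA leq_add2r.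
  by apply: leq_trans (leq_card_setU _ _) _; rewrite leq_add2l card_edge_img.
rewrite -mulr_suml -mulr_sumr mulrCA -mulrA exprS [leRHS]mulrCA.
rewrite [leLHS](_ : _ = (N%:R ^+ k)^-1 * (\sum_(q | loopless q) p ^+ #|edge_img q :\: F|) * (p ^+ #|F| * b ^+ r)); last by ring.
rewrite ler_wpM2r ?mulr_ge0 ?exprn_ge0 //; apply: hb => //.
exact: leq_trans (leq_addr _ _) hF.
Qed.

End Moments.

(** * Planted edges and Markov's inequality *)

Section UpperTail.
Variables (R : realType) (k : nat) (H : sgraph k) (N : nat).
Hypothesis N0 : (0 < N)%N.
Implicit Types (x : 'M[R]_N) (q : {ffun 'I_k -> 'I_N}) (G : sgraph N) (F : {set 'I_N * 'I_N}).

Notation m := (num_edges H).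
Notation D := (max_degree H).
Notation E := (edges H).

(** Union bound over the pairs of vertices that may collide. *)
Lemma avg_noninj :
  (N%:R ^+ k)^-1 * (\sum_(q : {ffun 'I_k -> 'I_N} | ~~ injectiveb q) 1) <= (k ^ 2)%:R / N%:R :> R.
Proof.
have NR : 0 < N%:R :> R by rewrite ltr0n.
apply: (@le_trans _ _ (\sum_(e : 'I_k * 'I_k | e.1 != e.2) (N%:R ^+ k)^-1 *
    \sum_(q : {ffun 'I_k -> 'I_N}) (q e.1 == q e.2)%:R)).
  rewrite -mulr_sumr exchange_big /= ler_wpM2l ?invr_ge0 ?exprn_ge0 ?ler0n //.
  rewrite [leLHS]big_mkcond; apply: ler_sum => q _.
  case: ifP => [/injectivePn[a [b nab hab]]|_]; last by rewrite sumr_ge0.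
  by rewrite (bigD1 (a, b)) //= hab eqxx lerDl sumr_ge0.
rewrite (eq_bigr (fun=> N%:R^-1)) => [|e ne]; last first.
  rewrite (marginal N0 (fun i j => (i == j)%:R) ne).
  rewrite (eq_bigr (fun=> 1)) => [|i _]; last first.
    by rewrite (bigD1 i) //= eqxx big1 ?addr0 // => j; rewrite eq_sym => /negbTE ->.
  by rewrite sumr_const card_ord expr2 invfM mulfVK ?gt_eqF.
rewrite sumr_const -[leLHS]mulr_natl ler_wpM2r ?invr_ge0 ?ler0n // ler_nat.
apply: leq_trans (max_card _) _; by rewrite card_prod card_ord expnS expn1.
Qed.

Lemma prod_planted (p : R) F q : injective q ->
  p ^+ #|edge_img H q :\: F| =
  \prod_(e in E) (if ordp (q e.1, q e.2) \in F then 1 else p).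
Proof.
move=> qi; rewrite -(big_imset (fun s => if s \in F then 1 else p)) /=; last first.
  move=> e f eE fE /ordp_eq; rewrite /= => -[[/qi h1 /qi h2]|[/qi h1 /qi h2]].
    by case: e f h1 h2 {eE fE} => [a b] [c d] /= -> ->.
  by move: eE fE; rewrite !inE h1 h2 => /andP[h _] /andP[h' _]; move: h h'; lia.
rewrite (bigID (mem F)) /= big1 ?mul1r => [|e /andP[_ ->] //].
rewrite (eq_bigr (fun=> p)) => [|e /andP[_ /negbTE ->] //].
rewrite prodr_const; congr (_ ^+ _); apply: eq_card => e.
by rewrite !inE andbC.
Qed.

(** For injective maps the left-hand side is the density of the array equal to 1 on [F] and to [p]
    elsewhere, to which [density_finner] applies; non-injective maps cost the last term. *)
Lemma planted_density (p : R) F : (0 < m)%N -> 0 <= p <= 1 ->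
  (N%:R ^+ k)^-1 * (\sum_(q | loopless H q) p ^+ #|edge_img H q :\: F|) <=
  (p ^+ D + 2 * #|F|%:R / N%:R ^+ 2) `^ (m%:R / D%:R) + (k ^ 2)%:R / N%:R.
Proof.
move=> m0 /andP[p0 p1]; have NR : 0 < N%:R :> R by rewrite ltr0n.
pose x : 'M[R]_N := \matrix_(i, j) (if ordp (i, j) \in F then 1 else p).
have D0 := max_degree_gt0 m0.
apply: (@le_trans _ _ (array_density H x + (N%:R ^+ k)^-1 *
   (\sum_(q : {ffun 'I_k -> 'I_N} | ~~ injectiveb q) 1))).
  rewrite array_densityE -mulrDr ler_wpM2l ?invr_ge0 ?exprn_ge0 ?ler0n //.
  rewrite big_mkcond [X in _ <= _ + X]big_mkcond -big_split /=; apply: ler_sum => q _.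
  have P0 : 0 <= \prod_(e in E) x (q e.1) (q e.2).
    by apply: prodr_ge0 => e _; rewrite mxE; case: ifP.
  case: (boolP (injectiveb q)) => [/injectiveP qi|_] /=.
    rewrite addr0; case: ifP => // _; rewrite prod_planted // le_eqVlt; apply/orP; left.
    by apply/eqP; apply: eq_bigr => e _; rewrite mxE.
  by case: ifP => _; [rewrite ler_wpDl // exprn_ile1|rewrite addr_ge0].
apply: lerD; last exact: avg_noninj.
apply: le_trans (density_finner N0 m0 _) _.
  by move=> i j; rewrite mxE; case: ifP.
apply: ge0_ler_powR; rewrite ?nnegrE ?divr_ge0 ?ler0n //.
- rewrite mulr_ge0 ?invr_ge0 ?exprn_ge0 ?ler0n // sumr_ge0 // => i _.
  by rewrite sumr_ge0 // => j _; rewrite exprn_ge0 // mxE; case: ifP.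
- by rewrite addr_ge0 ?exprn_ge0 // divr_ge0 ?exprn_ge0 ?ler0n ?mulr_ge0.
rewrite ler_pdivrMl ?exprn_gt0 // mulrDr mulrC [X in _ + X]mulrC divfK ?gt_eqF ?exprn_gt0 //.
rewrite pair_big /=.
apply: (@le_trans _ _ (\sum_(e : 'I_N * 'I_N) (p ^+ D + (ordp e \in F)%:R))).
  apply: ler_sum => -[i j] _; rewrite mxE /=; case: ifP => _.
    by rewrite expr1n lerDr exprn_ge0.
  by rewrite addr0.
rewrite big_split /= sumr_const card_prod card_ord -[_ *+ (N * N)]mulr_natl natrM -expr2.
rewrite [X in X + _ <= _]mulrC lerD2l -natr_sum -natrM ler_nat.
(* A planted pair comes from at most two ordered pairs, hence the factor 2. *)
rewrite (eq_bigr (fun e => if ordp e \in F then 1%N else 0%N)) => [|e _]; last by case: ifP.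
rewrite -big_mkcond sum1dep_card mul2n -addnn.
pose sw (e : 'I_N * 'I_N) := (e.2, e.1).
apply: (@leq_trans #|F :|: [set sw e | e in F]|).
  apply: subset_leq_card; apply/fintype.subsetP => e; rewrite !inE /ordp.
  case: ifP => [_ -> //|_ h]; apply/orP; right; apply/imsetP; exists (e.2, e.1) => //.
  by case: e {h}.
apply: leq_trans (leq_card_setU _ _) _; rewrite leq_add2l; exact: leq_imset_card.
Qed.

Lemma markov_moment (p b T : R) (r : nat) : 0 <= p <= 1 -> 0 < T ->
  \sum_(G : sgraph N) gnp p G * array_density H (adj_mx R G) ^+ r <= b ^+ r ->
  gnp_Pr p (fun G : sgraph N => T <= hom_density R H G) <= (b / T) ^+ r.
Proof.
move=> /andP[p0 p1] T0 hb; rewrite expr_div_n ler_pdivlMr ?exprn_gt0 //.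
apply: le_trans hb; rewrite /gnp_Pr mulr_suml [leLHS]big_mkcond /=.
have g0 G : 0 <= gnp p G by rewrite gnpE gnpx_ge0 // => i j; rewrite mxE p0.
apply: ler_sum => G _; case: ifP => [h|_].
  rewrite ler_wpM2l // lerXn2r ?nnegrE ?(ltW T0) //; last by rewrite -hom_densityE.
  by apply: density_ge0 => i j; rewrite mxE.
by rewrite mulr_ge0 // exprn_ge0 // density_ge0 // => i j; rewrite mxE.
Qed.

Lemma gnpx_eq x (y : 'M[R]_N) G : (forall e, up e -> x e.1 e.2 = y e.1 e.2) -> gnpx x G = gnpx y G.
Proof. by move=> h; apply: eq_bigr => e /h ->. Qed.

(** Use [E_density_ge] for [p] times the complete array, whose product measure is that of G(N,p). *)
Lemma E_density_scale (p : R) : 0 <= p <= 1 ->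
  p ^+ m * array_density H (complete_mx R N) <= gnp_E p (fun G : sgraph N => hom_density R H G).
Proof.
move=> /andP[p0 p1]; have [oi od os] := complete_mx_arrays R N.
have hx : arrays (p *: complete_mx R N).
  split=> [i j|i|i j]; rewrite !mxE.
  - by case: (_ != _); rewrite /= ?mulr1 ?mulr0 ?p0 ?lexx ?ler01.
  - by rewrite eqxx mulr0.
  - by rewrite eq_sym.
have -> : p ^+ m * array_density H (complete_mx R N) = array_density H (p *: complete_mx R N).
  rewrite !array_densityE mulrCA mulr_sumr; congr (_ * _); apply: eq_bigr => q _.
  rewrite [in RHS](eq_bigr (fun e => p * complete_mx R N (q e.1) (q e.2))) => [|e _]; last by rewrite mxE.
  by rewrite big_split prodr_const -num_edgesE.
apply: le_trans (E_density_ge H hx) _; rewrite le_eqVlt; apply/orP; left; apply/eqP.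
apply: eq_bigr => G _; rewrite hom_densityE gnpE; congr (_ * _).
by apply: gnpx_eq => e; rewrite /up !mxE neq_ltn => ->; rewrite mulr1.
Qed.

End UpperTail.

(** * The upper tail *)

Section Tail.
Variable R : realType.

Lemma powR_ge_eventually (a M : R) : 0 < a ->
  exists N0 : nat, forall N : nat, (N0 <= N)%N -> M <= N%:R `^ a.
Proof.
move=> a0; pose B := Num.max M 1; have B1 : 1 <= B by rewrite le_max lexx orbT.
have B0 : 0 <= B by exact: le_trans B1.
have hB : 0 <= B `^ a^-1 by exact: powR_ge0.
exists (Num.truncn (B `^ a^-1)).+1 => N hN.
apply: (@le_trans _ _ B); first by rewrite le_max lexx.
rewrite -[leLHS]powRr1 // -[X in B `^ X](mulVf (lt0r_neq0 a0)) powRrM.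
apply: ge0_ler_powR; rewrite ?nnegrE ?(ltW a0) ?ler0n //.
apply: (@le_trans _ _ (Num.truncn (B `^ a^-1)).+1%:R); last by rewrite ler_nat.
by have /andP[_ /ltW] := truncn_itv hB.
Qed.

Definition p_range (m N : nat) (p : R) :=
  N%:R `^ (- (1 / (m%:R + 3))) <= p <= 1 - N%:R^-1.

Lemma p_range_itv m N p : (0 < N)%N -> p_range m N p -> 0 < p < 1.
Proof.
move=> N0 /andP[h1 h2]; apply/andP; split.
  by apply: lt_le_trans h1; rewrite powR_gt0 // ltr0n.
by apply: le_lt_trans h2 _; rewrite ltrBlDr ltrDl invr_gt0 ltr0n.
Qed.

Lemma p_range_pow m N p a : (0 < N)%N -> p_range m N p -> 0 <= a ->
  N%:R `^ (- (a / (m%:R + 3))) <= p `^ a.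
Proof.
move=> N0 hp a0; have /andP[p0 _] := p_range_itv N0 hp; have /andP[h1 _] := hp.
have -> : - (a / (m%:R + 3)) = - (1 / (m%:R + 3)) * a by rewrite mulNr mulrAC mul1r.
by rewrite powRrM; apply: ge0_ler_powR; rewrite ?nnegrE ?powR_ge0 ?(ltW p0).
Qed.

(** The exponent on the left is positive, so errors of order [1 / N] are negligible against
    [p ^+ m]. *)
Lemma p_range_powN m N p : (0 < N)%N -> p_range m N p ->
  N%:R `^ (3 / (m%:R + 3)) <= p ^+ m * N%:R.
Proof.
move=> N0 hp; have /andP[p0 _] := p_range_itv N0 hp.
have NR : 0 < N%:R :> R by rewrite ltr0n.
have m3 : 0 < m%:R + 3 :> R by rewrite ltr_wpDl.
have -> : 3 / (m%:R + 3) = - (m%:R / (m%:R + 3)) + 1 :> R by field; rewrite gt_eqF.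
rewrite powRD; last by rewrite (gt_eqF NR) implybT.
rewrite powRr1 ?ler0n // ler_wpM2r ?ler0n // -powR_mulrn ?(ltW p0) //.
exact: p_range_pow.
Qed.

Variables (k : nat) (H : sgraph k).
Notation m := (num_edges H).
Notation D := (max_degree H).

Lemma upper_tail (u : R) : (0 < m)%N -> 1 < u ->
  exists c1 : R, 0 < c1 /\ exists N0 : nat, forall (N : nat) (p : R), (N0 <= N)%N ->
    p_range m N p ->
    gnp_Pr p (fun G : sgraph N => u * gnp_E p (fun G : sgraph N => hom_density R H G) <= hom_density R H G)
      <= expR (- (c1 * (N%:R ^+ 2 * p ^+ D))).
Proof.
move=> m0 u1; have D0 := max_degree_gt0 m0.
have mR : 0 < m%:R :> R by rewrite ltr0n.
have DR : 0 < D%:R :> R by rewrite ltr0n.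
(* The surplus [u - 1] is split in four: one part for planting, one for non-injective maps, one for
   the gap between moment and threshold, one for the loss in [E(X)]. *)
pose g : R := (u - 1) / 4; have g0 : 0 < g by rewrite divr_gt0 // subr_gt0.
have ug : u = 1 + 4 * g by rewrite /g; field.
(* Planting may raise [p ^+ D] by the factor [1 + y]; then [p ^+ m] grows by at most
   [expR (y * m) = 1 + g]. *)
pose y := ln (1 + g) / m%:R.
have lng : 0 < ln (1 + g) by rewrite ln_gt0 // ltrDl.
have y0 : 0 < y by rewrite divr_gt0.
pose th := (1 + 2 * g) / (1 + 3 * g).
have g3 : 0 < 1 + 3 * g by lra.
have th0 : 0 < th by rewrite divr_gt0 //; lra.
have th1 : th < 1 by rewrite ltr_pdivrMr // mul1r; lra.
have lnth : 0 < - ln th by rewrite oppr_gt0 ln_lt0 // th0.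
pose c1 := - ln th * y / (4 * m%:R).
have c10 : 0 < c1 by apply: divr_gt0; apply: mulr_gt0.
exists c1; split => //.
have [Na hNa] := @powR_ge_eventually (3 / (m%:R + 3)) (Num.max 1 ((k ^ 2)%:R / g)) ltac:(by rewrite divr_gt0 // ltr_wpDl).
have [Nb hNb] := @powR_ge_eventually 1 (4 * m%:R / y + (1 + 4 * g) * m%:R / g) ltr01.
exists (maxn 1 (maxn Na Nb)) => N p; rewrite !geq_max => /and3P[N0 /hNa ha /hNb hb] hp.
have /andP[p0 p1] := p_range_itv N0 hp.
have NR : 0 < N%:R :> R by rewrite ltr0n.
rewrite powRr1 ?(ltW NR) // in hb.
have {ha} := le_trans ha (p_range_powN N0 hp).
rewrite ge_max => /andP[ha1 ha2].
have pm0 : 0 < p ^+ m by exact: exprn_gt0.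
have pD0 : 0 < p ^+ D by exact: exprn_gt0.
have hk : (k ^ 2)%:R / N%:R <= g * p ^+ m.
  by rewrite ler_pdivrMr // -mulrA -ler_pdivrMl // mulrC.
have hND : N%:R <= N%:R ^+ 2 * p ^+ D.
  rewrite expr2 -mulrA ler_peMr ?(ltW NR) //; apply: le_trans ha1 _.
  by rewrite mulrC ler_wpM2l ?(ltW NR) // ler_wiXn2l ?(ltW p0) ?(ltW p1) ?max_degree_le.
set V := N%:R ^+ 2 * p ^+ D in hND *.
have V0 : 0 < V by exact: lt_le_trans NR hND.
have hb1 : 4 * m%:R / y <= N%:R.
  apply: le_trans hb; rewrite lerDl; apply: divr_ge0; last exact: ltW.
  by apply: mulr_ge0; [clear - g0|clear - mR]; lra.
have hb2 : (1 + 4 * g) * m%:R / g <= N%:R.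
  apply: le_trans hb; rewrite lerDr; apply: divr_ge0; last exact: ltW.
  by apply: mulr_ge0; clear - mR; lra.
(* For a moment of order [r <= w] at most [r * m <= y * V / 2] pairs are planted, as [y] permits.
   Since [2 <= w], truncation keeps [r >= w / 2]. *)
pose w := y / 2 * V / m%:R.
have w0 : 0 <= w by rewrite /w divr_ge0 ?ler0n // mulr_ge0 ?(ltW V0) // divr_ge0 // ltW.
pose r := Num.truncn w.
have /andP[r1 r2] := truncn_itv w0.
have w2 : 2 <= w.
  rewrite /w ler_pdivlMr //; rewrite ler_pdivrMr // in hb1.
  have : N%:R * y <= V * y by rewrite ler_wpM2r // ltW.
  by clear - hb1; lra.
pose b := (1 + 2 * g) * p ^+ m.
have b0 : 0 <= b by rewrite mulr_ge0 ?(ltW pm0) //; clear - g0; lra.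
pose T := u * gnp_E p (fun G : sgraph N => hom_density R H G).
have hT : (1 + 3 * g) * p ^+ m <= T.
  have h1 : p ^+ m * (1 - m%:R / N%:R) <= gnp_E p (fun G : sgraph N => hom_density R H G).
    apply: le_trans (E_density_scale H N _); last by rewrite (ltW p0) ltW.
    by rewrite ler_wpM2l ?(ltW pm0) // density_complete_mx_ge.
  apply: (@le_trans _ _ (u * (p ^+ m * (1 - m%:R / N%:R)))); last first.
    by rewrite ler_wpM2l //; clear - u1; lra.
  rewrite [leRHS]mulrCA [leLHS]mulrC ler_wpM2l ?(ltW pm0) // ug.
  have : (1 + 4 * g) * m%:R / N%:R <= g.
    by rewrite ler_pdivrMr //; rewrite ler_pdivrMr // in hb2; clear - hb2; lra.
  by clear; lra.
have T0 : 0 < T by apply: lt_le_trans hT; rewrite mulr_gt0.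
have hM : \sum_(G : sgraph N) gnp p G * array_density H (adj_mx R G) ^+ r <= b ^+ r.
  have hp01 : 0 <= p <= 1 by rewrite (ltW p0) ltW.
  have := @moment_bound R k H N p b (r * m) hp01 b0.
  move=> /(_ _ r finset.set0); rewrite cards0 add0n leqnn expr0 mul1r.
  under eq_bigr => G _.
    have -> : has_edges finset.set0 G by apply/forall_inP => e; rewrite inE.
    rewrite mul1r; over.
  apply => // [F hF upF|e]; last by rewrite inE.
  apply: le_trans (planted_density N0 F m0 hp01) _.
  have hb3 : (p ^+ D + 2 * #|F|%:R / N%:R ^+ 2) `^ (m%:R / D%:R) <= p ^+ m * (1 + g).
    have hFR : 2 * #|F|%:R <= y * V.
      have : #|F|%:R <= r%:R * m%:R :> R by rewrite -natrM ler_nat.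
      have : r%:R * m%:R <= w * m%:R by rewrite ler_wpM2r // ler0n.
      rewrite /w divfK ?gt_eqF //; clear; lra.
    apply: (@le_trans _ _ ((p ^+ D * (1 + y)) `^ (m%:R / D%:R))).
      apply: ge0_ler_powR; rewrite ?nnegrE ?divr_ge0 ?ler0n //.
      - by rewrite addr_ge0 ?(ltW pD0) // divr_ge0 ?exprn_ge0 ?ler0n ?mulr_ge0.
      - by rewrite mulr_ge0 ?(ltW pD0) //; clear - y0; lra.
      rewrite mulrDr mulr1 lerD2l ler_pdivrMr ?exprn_gt0 //.
      by apply: le_trans hFR _; rewrite /V; clear; lra.
    rewrite powRM ?(ltW pD0) //; last by clear - y0; lra.
    rewrite -powR_mulrn ?(ltW p0) // -powRrM mulrCA mulfV ?gt_eqF // mulr1.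
    rewrite powR_mulrn ?(ltW p0) // ler_wpM2l ?(ltW pm0) //.
    apply: (@le_trans _ _ (expR y `^ (m%:R / D%:R))).
      apply: ge0_ler_powR; rewrite ?nnegrE ?divr_ge0 ?ler0n ?expR_ge0 ?expR_ge1Dx //; clear - y0; lra.
    rewrite -expRM; apply: (@le_trans _ _ (expR (y * m%:R))).
      rewrite ler_expR ler_wpM2l ?(ltW y0) // ler_pdivrMr // ler_peMr ?ler0n //.
      by rewrite ler1n.
    by rewrite /y divfK ?gt_eqF // lnK // posrE; clear - g0; lra.
  by rewrite /b; move: hb3 hk; clear; lra.
apply: le_trans (markov_moment _ _ _) _; [ |exact: T0|exact: hM|].
  by rewrite (ltW p0) ltW.
apply: (@le_trans _ _ (th ^+ r)).
  rewrite lerXn2r ?nnegrE ?(ltW th0) ?divr_ge0 ?(ltW T0) //.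
  rewrite ler_pdivrMr //; apply: (@le_trans _ _ (th * ((1 + 3 * g) * p ^+ m))).
    by rewrite mulrA /th divfK ?gt_eqF.
  by rewrite ler_wpM2l // ltW.
have -> : th ^+ r = expR (r%:R * ln th) by rewrite expRM_natl lnK // posrE.
rewrite ler_expR.
have hr : w / 2 <= r%:R by rewrite -natr1 in r2; clear - r2 w2; lra.
have : w / 2 * (- ln th) <= r%:R * (- ln th) by rewrite ler_wpM2r // ltW.
have -> : c1 * V = w / 2 * (- ln th) by rewrite /c1 /w; field; rewrite gt_eqF.
by clear; lra.
Qed.

End Tail.

(** * Relative entropy *)

Section Entropy.
Variable R : realType.
Implicit Types p v w t : R.

Lemma xln_ge v w p : 0 <= v -> 0 < w -> 0 < p ->
  v * ln (w / p) + (v - w) <= v * ln (v / p).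
Proof.
rewrite le_eqVlt => /orP[/eqP <-|v0] w0 p0; first by rewrite !mul0r add0r sub0r oppr_le0 ltW.
rewrite !ln_div ?posrE // !mulrBr.
have := ln_le_sub1 (divr_gt0 w0 v0); rewrite ln_div ?posrE // => h.
have := ler_wpM2l (ltW v0) h; rewrite mulrBr [v * (w / v - 1)]mulrBr mulrCA mulfV ?gt_eqF // !mulr1.
lra.
Qed.

(** Convexity: the left-hand side is the tangent to [Ip p] at [w], evaluated at [v]. *)
Lemma gibbs_pt p v w : 0 < p < 1 -> 0 <= v <= 1 -> 0 < w < 1 ->
  v * ln (w / p) + (1 - v) * ln ((1 - w) / (1 - p)) <= Ip p v.
Proof.
move=> /andP[p0 p1] /andP[v0 v1] /andP[w0 w1].
have h1 := xln_ge v0 w0 p0.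
have : (1 - v) * ln ((1 - w) / (1 - p)) + ((1 - v) - (1 - w)) <= (1 - v) * ln ((1 - v) / (1 - p)).
  by apply: xln_ge; rewrite ?subr_ge0 ?subr_gt0.
rewrite /Ip; lra.
Qed.

Lemma Ip_ge0 p v : 0 < p < 1 -> 0 <= v <= 1 -> 0 <= Ip p v.
Proof.
move=> hp hv; apply: le_trans (gibbs_pt hp hv hp).
have /andP[p0 p1] := hp.
by rewrite !divff ?gt_eqF ?subr_gt0 // ln1 !mulr0 addr0.
Qed.

Lemma Ip1 p : 0 < p -> Ip p 1 = - ln p.
Proof. by move=> p0; rewrite /Ip subrr mul0r addr0 !mul1r lnV. Qed.

(** Convexity between [v] and 1, where [Ip p] takes the value [- ln p]; both end values are compared
    with the tangent at the mixture [w]. *)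
Lemma Ip_mix p v t : 0 < p < 1 -> 0 <= v <= 1 -> 0 <= t <= 1 ->
  Ip p ((1 - t) * v + t) <= Ip p v + t * (- ln p).
Proof.
move=> hp hv ht; have /andP[p0 p1] := hp; have /andP[v0 v1] := hv; have /andP[t0 t1] := ht.
have Iv := Ip_ge0 hp hv.
have lnp : 0 <= - ln p by rewrite oppr_ge0 ln_le0 // ltW.
set w := (1 - t) * v + t.
have w0 : 0 <= w by rewrite addr_ge0 // mulr_ge0 // subr_ge0.
have hw : 1 - w = (1 - t) * (1 - v) by rewrite /w; ring.
have w1 : w <= 1 by rewrite -subr_ge0 hw mulr_ge0 // subr_ge0.
(* The tangent requires [0 < w < 1]. If [w = 0] then [t = 0], and if [w = 1] then [t] or [v] is
   1. *)
move: w0; rewrite le_eqVlt => /orP[/eqP w0|w0].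
  have tz : t = 0.
    by apply/eqP; rewrite eq_le t0 andbT [leRHS]w0 /w lerDr mulr_ge0 // subr_ge0.
  by rewrite /w tz subr0 mul1r addr0 mul0r addr0.
move: w1; rewrite le_eqVlt => /orP[/eqP w1|w1].
  move/eqP: hw; rewrite w1 Ip1 // subrr eq_sym mulf_eq0 !subr_eq0 => /orP[] /eqP <-.
    by rewrite mul1r lerDr.
  by rewrite Ip1 // lerDl mulr_ge0.
have hww : 0 < w < 1 by rewrite w0 w1.
have h1 := gibbs_pt hp hv hww.
have h01 : 0 <= (1 : R) <= 1 by rewrite ler01 lexx.
have := gibbs_pt hp h01 hww; rewrite subrr mul0r addr0 mul1r Ip1 // => h2.
have h3 : (1 - t) * (v * ln (w / p) + (1 - v) * ln ((1 - w) / (1 - p))) <= (1 - t) * Ip p v.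
  by rewrite ler_wpM2l // subr_ge0.
have h4 : t * ln (w / p) <= t * (- ln p) by rewrite ler_wpM2l.
have h5 : 0 <= t * Ip p v by exact: mulr_ge0.
have -> : Ip p w = ((1 - t) * v + t) * ln (w / p) + (1 - t) * (1 - v) * ln ((1 - w) / (1 - p)).
  by rewrite /Ip -/w hw.
lra.
Qed.

(** The slope of [Ip p] is infinite at 1, so use the tangent at [1 - 1/N], whose slope is at most
    [ln N - ln p]. *)
Lemma Ip1_le p v (N : nat) : (2 <= N)%N -> 0 < p < 1 -> 0 <= v <= 1 ->
  - ln p <= Ip p v + (1 - v) * (ln N%:R - ln p) + 2 / N%:R.
Proof.
move=> N2 hp hv; have /andP[p0 p1] := hp; have /andP[v0 v1] := hv.
have NR : 2 <= N%:R :> R by rewrite ler_nat.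
have N0 : 0 < N%:R :> R by lra.
have iN : 0 < N%:R^-1 :> R by rewrite invr_gt0.
have iN2 : N%:R^-1 <= 2^-1 :> R by rewrite lef_pV2 ?posrE.
pose w : R := 1 - N%:R^-1.
have hw : 0 < w < 1 by rewrite /w; apply/andP; split; lra.
have /andP[w0 w1] := hw.
have := gibbs_pt hp hv hw.
have -> : 1 - w = N%:R^-1 by rewrite /w; ring.
have q0 : 0 < 1 - p by rewrite subr_gt0.
rewrite !ln_div ?posrE // lnV ?posrE // => h.
have h1 : - (2 / N%:R) <= ln w.
  have := @ln_le_sub1 R w^-1; rewrite invr_gt0 lnV ?posrE // => /(_ w0) hh.
  have : w^-1 - 1 <= 2 / N%:R.
    rewrite lerBlDr -[leLHS]mul1r ler_pdivrMr // /w.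
    set z := N%:R^-1 in iN iN2 *; nra.
  lra.
have h2 : ln (1 - p) <= 0 by rewrite ln_le0 //; lra.
have h3 : v * (- (2 / N%:R)) <= v * ln w by rewrite ler_wpM2l.
have h4 : (1 - v) * ln (1 - p) <= 0 by rewrite mulr_ge0_le0 // subr_ge0.
have h5 : v * (2 / N%:R) <= 2 / N%:R by rewrite ler_piMl // divr_ge0 // ltW.
lra.
Qed.

(** With [s] the square root of [v], the left-hand side is [4 (s ln s)^2], and [- s ln s] lies in
    [0,1]. *)
Lemma xln2_le v : 0 <= v <= 1 -> v * ln v ^+ 2 <= 4.
Proof.
move=> /andP[]; rewrite le_eqVlt => /orP[/eqP <- _|v0 v1]; first by rewrite mul0r.
pose s := Num.sqrt v; have s0 : 0 < s by rewrite sqrtr_gt0.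
have vs : v = s ^+ 2 by rewrite sqr_sqrtr // ltW.
have s1 : s <= 1.
  by rewrite -(@ler_pXn2r _ 2) ?nnegrE ?(ltW s0) // -vs expr1n.
have l0 : ln s <= 0 by exact: ln_le0.
have := @ln_le_sub1 R s^-1; rewrite invr_gt0 lnV ?posrE // => /(_ s0) h.
have h1 : - (s * ln s) <= 1.
  have := ler_wpM2l (ltW s0) h; rewrite mulrBr mulfV ?gt_eqF //; lra.
have h2 : 0 <= - (s * ln s) by rewrite oppr_ge0 mulr_ge0_le0 // ltW.
have -> : v * ln v ^+ 2 = 4 * (- (s * ln s)) ^+ 2.
  by rewrite {1}vs vs lnXn // mulr2n; ring.
by rewrite ler_piMr // exprn_ile1.
Qed.

(** The log-likelihood ratio of edge probability [v] against [p]; its mean under [v] is the relative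
    entropy [Ip p v]. *)
Definition log_ratio1 p v (b : bool) : R := if b then ln (v / p) else ln ((1 - v) / (1 - p)).

Lemma log_ratio1_mean p v : v * log_ratio1 p v true + (1 - v) * log_ratio1 p v false = Ip p v.
Proof. by []. Qed.

Lemma xln_div2_le v p (l : R) : 0 <= v <= 1 -> 0 < p -> - l <= ln p <= 0 ->
  v * ln (v / p) ^+ 2 <= 8 + 2 * v * l ^+ 2.
Proof.
move=> hv p0 /andP[l1 l2]; have h := xln2_le hv; have /andP[v0 v1] := hv.
have l2' : 0 <= l ^+ 2 - ln p ^+ 2 by rewrite subr_sqr mulr_ge0; lra.
move: v0; rewrite le_eqVlt => /orP[/eqP <-|v0]; first by rewrite mulr0 !mul0r addr0.
rewrite ln_div ?posrE //.
have h1 : 0 <= v * (ln v + ln p) ^+ 2 by rewrite mulr_ge0 ?sqr_ge0 // ltW.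
have h2 : 0 <= v * (l ^+ 2 - ln p ^+ 2) by rewrite mulr_ge0 // ltW.
lra.
Qed.

Lemma log_ratio1_sqr_le p v (l : R) : 0 < p < 1 -> 0 <= v <= 1 -> - l <= ln p -> - l <= ln (1 - p) ->
  v * log_ratio1 p v true ^+ 2 + (1 - v) * log_ratio1 p v false ^+ 2 <= 16 + 2 * l ^+ 2.
Proof.
move=> /andP[p0 p1] hv h1 h2; have /andP[v0 v1] := hv.
have a1 : v * ln (v / p) ^+ 2 <= 8 + 2 * v * l ^+ 2.
  by apply: xln_div2_le => //; rewrite h1 ln_le0 // ltW.
have a2 : (1 - v) * ln ((1 - v) / (1 - p)) ^+ 2 <= 8 + 2 * (1 - v) * l ^+ 2.
  apply: xln_div2_le => //; first by apply/andP; split; lra.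
    by rewrite subr_gt0.
  by rewrite h2 ln_le0 //; lra.
rewrite /log_ratio1; lra.
Qed.

End Entropy.

(** * Change of measure to independent edges *)

Section Tilting.
Variables (R : realType) (N : nat).
Implicit Types (x : 'M[R]_N) (G : sgraph N) (A : pred (sgraph N)) (p : R).

Definition log_ratio p x G := \sum_(e | up e) log_ratio1 p (x e.1 e.2) (G e.1 e.2).

Lemma Ip_arrayE p x : Ip_array p x = \sum_(e | up e) Ip p (x e.1 e.2).
Proof. by rewrite /Ip_array pair_big_dep. Qed.

Lemma Ip_array_ge0 p x : 0 < p < 1 -> arrays x -> 0 <= Ip_array p x.
Proof. by move=> hp [hx _ _]; rewrite Ip_arrayE sumr_ge0 // => e _; exact: Ip_ge0. Qed.

Lemma gnp_gt0 p G : 0 < p < 1 -> 0 < gnp p G.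
Proof.
move=> /andP[p0 p1]; rewrite gnpE prodr_gt0 // => e _; rewrite mxE.
by case: ifP; rewrite ?subr_gt0.
Qed.

Lemma gnpx_log_ratio p x G : 0 < p < 1 ->
  (forall e, up e -> if G e.1 e.2 then 0 < x e.1 e.2 else x e.1 e.2 < 1) ->
  gnpx x G = gnp p G * expR (log_ratio p x G).
Proof.
move=> /andP[p0 p1] h; rewrite gnpE /log_ratio expR_sum -big_split; apply: eq_bigr => e ue /=.
rewrite mxE /log_ratio1; move: (h e ue); case: ifP => _ he.
  by rewrite lnK ?posrE ?divr_gt0 // mulrC divfK ?gt_eqF.
by rewrite lnK ?posrE ?divr_gt0 ?subr_gt0 // mulrC divfK ?gt_eqF ?subr_gt0.
Qed.

(* Only an inequality: [log_ratio] has junk summands ([ln 0 = 0]) at the entries 0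
   and 1 of [x], where the left-hand side vanishes. *)
Lemma gnp_ge_tilt p x G : 0 < p < 1 -> (forall i j, 0 <= x i j <= 1) ->
  gnpx x G * expR (- log_ratio p x G) <= gnp p G.
Proof.
move=> hp hx.
have [/forallP h|] := boolP [forall e, up e ==> (if G e.1 e.2 then 0 < x e.1 e.2 else x e.1 e.2 < 1)].
  rewrite (@gnpx_log_ratio p) // => [|e ue]; last by have := h e; rewrite ue.
  by rewrite -mulrA -expRD subrr expR0 mulr1.
rewrite negb_forall => /existsP[e]; rewrite negb_imply => /andP[ue he].
rewrite [X in X * _](_ : _ = 0) ?mul0r; first by rewrite ltW ?gnp_gt0.
rewrite /gnpx (bigD1 e) //= [X in X * _](_ : _ = 0) ?mul0r //.
have /andP[h0 h1] := hx e.1 e.2.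
move: he; case: ifP => _; rewrite -leNgt => h; apply/eqP; rewrite eq_le ?h ?h0 //.
by rewrite subr_le0 h subr_ge0 h1.
Qed.

Lemma card_up : (#|[pred e : 'I_N * 'I_N | up e]| <= N ^ 2)%N.
Proof. by apply: leq_trans (max_card _) _; rewrite card_prod card_ord expnS expn1. Qed.

Lemma sum_up_le (F : 'I_N * 'I_N -> R) c : 0 <= c -> (forall e, up e -> F e <= c) ->
  \sum_(e | up e) F e <= c * N%:R ^+ 2.
Proof.
move=> c0 hF; apply: (@le_trans _ _ (\sum_(e : 'I_N * 'I_N | up e) c)).
  by apply: ler_sum.
rewrite sumr_const -[leLHS]mulr_natr ler_wpM2l // -natrX ler_nat; exact: card_up.
Qed.

(** The summands are independent, and each variance is at most the second moment, which
    [log_ratio1_sqr_le] bounds. *)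
Lemma Var_log_ratio p x (l : R) : 0 < p < 1 -> (forall i j, 0 <= x i j <= 1) ->
  - l <= ln p -> - l <= ln (1 - p) ->
  \sum_G gnpx x G * (log_ratio p x G - Ip_array p x) ^+ 2 <= (16 + 2 * l ^+ 2) * N%:R ^+ 2.
Proof.
move=> hp hx l1 l2.
pose xi e b := log_ratio1 p (x e.1 e.2) b - Ip p (x e.1 e.2).
have -> : \sum_G gnpx x G * (log_ratio p x G - Ip_array p x) ^+ 2 =
    \sum_G gnpx x G * (\sum_(e | up e) xi e (G e.1 e.2)) ^+ 2.
  by apply: eq_bigr => G _; rewrite Ip_arrayE -sumrB.
rewrite E_sum_sqr => [|e ue]; last by rewrite /xi -(log_ratio1_mean p (x e.1 e.2)); ring.
apply: sum_up_le => [|e ue]; first by rewrite addr_ge0 // mulr_ge0 // sqr_ge0.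
apply: le_trans (log_ratio1_sqr_le hp (hx e.1 e.2) l1 l2).
rewrite /xi -(log_ratio1_mean p (x e.1 e.2)) -subr_ge0.
set v := x e.1 e.2; set a := log_ratio1 p v true; set b := log_ratio1 p v false.
have -> : v * a ^+ 2 + (1 - v) * b ^+ 2 - (v * (a - (v * a + (1 - v) * b)) ^+ 2 +
  (1 - v) * (b - (v * a + (1 - v) * b)) ^+ 2) = (v * a + (1 - v) * b) ^+ 2 by ring.
exact: sqr_ge0.
Qed.

(* Uses the tangent [exp(- L) >= exp(- a) (1 + a - L)] at [a = Ip_array p x + s / Q]. *)
Lemma tilt_lower p x A (s Q : R) : 0 < p < 1 -> (forall i j, 0 <= x i j <= 1) ->
  0 < s -> \sum_G gnpx x G * (log_ratio p x G - Ip_array p x) ^+ 2 <= s ^+ 2 ->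
  0 < Q -> Q = \sum_(G | A G) gnpx x G ->
  Q * expR (- (Ip_array p x + s / Q)) <= gnp_Pr p A.
Proof.
move=> hp hx s0 hV Q0 hQ; set a := Ip_array p x + s / Q.
have g0 G : 0 <= gnpx x G by exact: gnpx_ge0.
(* In place of Cauchy-Schwarz: [z <= (z^2 / s + s) / 2] pointwise. The right-hand side is
   nonnegative, so its sum may be extended from [A] to all graphs. *)
have hL : \sum_(G | A G) gnpx x G * (log_ratio p x G - Ip_array p x) <= s.
  have hs : \sum_G gnpx x G * (((log_ratio p x G - Ip_array p x) ^+ 2 / s + s) / 2) <= s.
    have -> : \sum_G gnpx x G * (((log_ratio p x G - Ip_array p x) ^+ 2 / s + s) / 2) =
       ((\sum_G gnpx x G * (log_ratio p x G - Ip_array p x) ^+ 2) / s + s) / 2.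
      rewrite -[X in _ = (_ + X) / _]mulr1 -(E_one x) mulr_sumr mulr_suml -big_split /= mulr_suml.
      by apply: eq_bigr => G _; ring.
    have : (\sum_G gnpx x G * (log_ratio p x G - Ip_array p x) ^+ 2) / s <= s.
      by rewrite ler_pdivrMr // -expr2.
    by clear; lra.
  apply: le_trans hs; rewrite [leLHS]big_mkcond; apply: ler_sum => G _.
  set z := log_ratio p x G - _.
  have hz : z <= (z ^+ 2 / s + s) / 2.
    rewrite ler_pdivlMr // -(ler_pM2r s0) [leRHS]mulrDl divfK ?gt_eqF //.
    have := sqr_ge0 (z - s); rewrite sqrrB; clear; lra.
  have hz0 : 0 <= (z ^+ 2 / s + s) / 2.
    by rewrite divr_ge0 // addr_ge0 ?divr_ge0 ?sqr_ge0 // ltW.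
  by case: ifP => _; [apply: ler_wpM2l|apply: mulr_ge0].
apply: (@le_trans _ _ (\sum_(G | A G) gnpx x G * (expR (- a) * (1 + a - log_ratio p x G)))); last first.
  apply: ler_sum => G _; apply: le_trans (gnp_ge_tilt G hp hx).
  rewrite ler_wpM2l // -[leRHS](_ : expR (- a) * expR (a - log_ratio p x G) = _); last first.
    by rewrite -expRD; congr expR; ring.
  by rewrite ler_wpM2l ?expR_ge0 // -addrA expR_ge1Dx.
have -> : \sum_(G | A G) gnpx x G * (expR (- a) * (1 + a - log_ratio p x G)) =
   expR (- a) * (Q * (1 + a - Ip_array p x) - \sum_(G | A G) gnpx x G * (log_ratio p x G - Ip_array p x)).
  rewrite hQ mulr_suml -sumrB mulr_sumr; apply: eq_bigr => G _; ring.
rewrite mulrC ler_wpM2l ?expR_ge0 //.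
have -> : Q * (1 + a - Ip_array p x) = Q + s by rewrite /a; field; rewrite gt_eqF.
by move: hL; clear; lra.
Qed.

Lemma Ip_array_mix p x t : 0 < p < 1 -> arrays x -> 0 <= t <= 1 ->
  Ip_array p (mix x t) <= Ip_array p x + t * (- ln p) * N%:R ^+ 2.
Proof.
move=> hp [hx _ _] ht; have /andP[p0 p1] := hp.
rewrite !Ip_arrayE -lerBlDl -sumrB; apply: sum_up_le => [|e ue].
  by rewrite mulr_ge0 ?oppr_ge0 ?ln_le0 ?(ltW p1) //; case/andP: ht.
rewrite lerBlDl !mxE neq_ltn; rewrite [up e]/up in ue; rewrite ue mulr1.
exact: Ip_mix.
Qed.

End Tilting.

(** * Lower bound on the tail probability *)

Section LowerBound.
Variable R : realType.

Lemma ln_nat_ge1 (N : nat) : (4 <= N)%N -> 1 <= ln N%:R :> R.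
Proof.
move=> N4; have h4 : 4 <= N%:R :> R by rewrite ler_nat.
have l4 : ln 4 <= ln N%:R :> R by rewrite ler_ln ?posrE //; clear - h4; lra.
apply: le_trans l4.
have -> : 4 = 2 ^+ 2 :> R by ring.
rewrite lnXn // mulr2n.
have := @ln_le_sub1 R 2^-1; rewrite invr_gt0 lnV ?posrE // => /(_ (ltr0Sn _ _)).
by clear; lra.
Qed.

Lemma p_range_ln m N (p : R) : (0 < N)%N -> p_range m N p ->
  - ln N%:R <= ln p /\ - ln N%:R <= ln (1 - p).
Proof.
move=> N0 hp; have /andP[p0 p1] := p_range_itv N0 hp; have /andP[h1 h2] := hp.
have NR : 0 < N%:R :> R by rewrite ltr0n.
split; last first.
  rewrite -lnV ?posrE // ler_ln ?posrE ?invr_gt0 ?subr_gt0 //.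
  by move: h2; clear; lra.
apply: (@le_trans _ _ (ln (N%:R `^ (- (1 / (m%:R + 3)))))); last first.
  by rewrite ler_ln ?posrE ?powR_gt0.
have m3 : 1 <= m%:R + 3 :> R by have := ler0n R m; clear; lra.
rewrite ln_powR mulNr lerN2 ler_piMl ?ln_ge0 ?ler1n // div1r invf_le1 //.
Qed.

Variables (k : nat) (H : sgraph k).
Notation m := (num_edges H).

(* Markov's inequality for the deficit [t(K_N) - X], whose mean is at most
   [(1 - t^m)] times that allowed by [T]; it holds however close [T] is to [t(K_N)]. *)
Lemma tilted_prob_ge (N : nat) (x : 'M[R]_N) (T t : R) : (0 < N)%N ->
  arrays x -> T <= array_density H x -> 0 < t <= 1 ->
  t ^+ m <= \sum_(G : sgraph N | T <= hom_density R H G) gnpx (mix x t) G.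
Proof.
move=> N0 hx hT /andP[t0 t1].
have ht : 0 <= t <= 1 by rewrite ltW.
have hm := mix_arrays ht hx; have [hmi _ _] := hm.
have g0 G : 0 <= gnpx (mix x t) G by exact: gnpx_ge0.
set Q := \sum_(G | _) _.
set kap := array_density H (complete_mx R N).
have hXk (G : sgraph N) : hom_density R H G <= kap.
  rewrite hom_densityE /kap; apply: density_mono => i j; rewrite !mxE ler0n ler_nat /=.
  by have [<-|_] := eqVneq i j; rewrite ?sgraph_irr ?leq_b1.
have tm1 : t ^+ m <= 1 by rewrite exprn_ile1 // ltW.
have eQ : 1 - Q = \sum_(G : sgraph N | ~~ (T <= hom_density R H G)) gnpx (mix x t) G.
  rewrite -(E_one (mix x t)) (bigID (fun G : sgraph N => T <= hom_density R H G)) /=.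
  by rewrite -/Q [Q + _]addrC addrK.
have hD : \sum_G gnpx (mix x t) G * (kap - hom_density R H G) <= (1 - t ^+ m) * (kap - T).
  apply: (@le_trans _ _ (kap - array_density H (mix x t))).
    rewrite (eq_bigr (fun G => gnpx (mix x t) G * kap - gnpx (mix x t) G * array_density H (adj_mx R G))); last first.
      by move=> G _; rewrite mulrBr hom_densityE.
    by rewrite sumrB -mulr_suml E_one mul1r lerD2l lerN2 E_density_ge.
  apply: le_trans (density_mix H ht hx) _.
  by rewrite ler_wpM2l ?subr_ge0 // lerD2l lerN2.
have hr : 0 <= kap - T.
  by rewrite subr_ge0; apply: le_trans hT _; exact: density_le_complete_mx.
have hD2 : \sum_(G : sgraph N | ~~ (T <= hom_density R H G)) gnpx (mix x t) G * (kap - hom_density R H G)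
   <= (1 - t ^+ m) * (kap - T).
  apply: le_trans hD; rewrite [leLHS]big_mkcond; apply: ler_sum => G _.
  by case: ifP => _ //; rewrite mulr_ge0 // subr_ge0.
suff : 1 - Q <= 1 - t ^+ m by rewrite lerD2l lerN2.
(* If [T] equals the density of the complete graph, the deficit has mean 0 on the failing graphs but
   is positive on each, so they have weight 0. *)
move: hr; rewrite le_eqVlt => /orP[/eqP r0|r0].
  rewrite -r0 mulr0 in hD2; rewrite eQ big1 ?subr_ge0 // => G hG.
  have pos (G' : sgraph N) : ~~ (T <= hom_density R H G') -> 0 < kap - hom_density R H G'.
    by rewrite -ltNge => h; rewrite subr_gt0 (lt_le_trans h) // -subr_ge0 -r0.
  have nn (G' : sgraph N) : ~~ (T <= hom_density R H G') ->
     0 <= gnpx (mix x t) G' * (kap - hom_density R H G').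
    by move=> h; rewrite mulr_ge0 // ltW // pos.
  have : \sum_(G : sgraph N | ~~ (T <= hom_density R H G)) gnpx (mix x t) G * (kap - hom_density R H G) == 0.
    by rewrite eq_le hD2 sumr_ge0.
  rewrite psumr_eq0 // => /allP/(_ G (mem_index_enum _)); rewrite hG /= mulf_eq0 => /orP[/eqP //|].
  by rewrite gt_eqF // pos.
rewrite -(ler_pM2r r0); apply: le_trans hD2; rewrite eQ mulr_suml.
apply: ler_sum => G; rewrite -ltNge => /ltW h.
by rewrite ler_wpM2l // lerD2l lerN2.
Qed.

Lemma log_prob_ge (N : nat) (p T : R) (x : 'M[R]_N) : (0 < m)%N -> (4 <= N)%N ->
  p_range m N p -> arrays x -> T <= array_density H x ->
  - ln (gnp_Pr p (fun G : sgraph N => T <= hom_density R H G)) <=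
  Ip_array p x + 7 * (ln N%:R * N%:R `^ (2 - 1 / (2 * m%:R))).
Proof.
move=> m0 N4 hp hx hT; have N0 : (0 < N)%N by exact: leq_trans N4.
have hp01 := p_range_itv N0 hp; have [lp lq] := p_range_ln N0 hp.
have /andP[p0 p1] := hp01.
have ln1 := ln_nat_ge1 N4.
have n0 : 0 < N%:R :> R by rewrite ltr0n.
have n1 : 1 <= N%:R :> R by rewrite ler1n.
have mR : 1 <= m%:R :> R by rewrite ler1n.
have mN0 : m%:R != 0 :> R by rewrite gt_eqF // (lt_le_trans _ mR).
set n : R := N%:R in lp lq ln1 n0 n1 *.
(* This makes [t ^+ m = n^(-1/2)], so the fluctuation cost [s / Q] is of order [n^(3/2) ln n], at
   most the order of the entropy cost [t n^2 ln n]; the two agree at [m = 1]. *)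
pose t := n `^ (- (1 / (2 * m%:R))).
have t0 : 0 < t by rewrite powR_gt0.
have t1 : t <= 1.
  rewrite /t -[leRHS](powRr0 n) ler_powR // oppr_le0 divr_ge0 // mulr_ge0 // ler0n.
have tm : t ^+ m = n `^ (- (1 / 2)).
  by rewrite -powR_mulrn ?(ltW t0) // /t -powRrM; congr (_ `^ _); field.
have hQ : 0 < t <= 1 by rewrite t0.
have := tilted_prob_ge N0 hx hT hQ.
set Q := \sum_(G | _) _ => Qt.
have Q0 : 0 < Q by apply: lt_le_trans Qt; rewrite exprn_gt0.
have ht : 0 <= t <= 1 by rewrite t1 ltW.
have [hmi _ _] := mix_arrays ht hx.
(* As [ln n >= 1], the variance factor [16 + 2 ln^2 n] is at most [25 ln^2 n]. *)
pose s := 5 * (n * ln n).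
have l0 : 0 < ln n by exact: lt_le_trans ln1.
have nl0 : 0 < n * ln n by exact: mulr_gt0.
have s0 : 0 < s by exact: mulr_gt0.
have hV : \sum_G gnpx (mix x t) G * (log_ratio p (mix x t) G - Ip_array p (mix x t)) ^+ 2 <= s ^+ 2.
  apply: le_trans (Var_log_ratio hp01 hmi lp lq) _.
  have -> : s ^+ 2 = 25 * ln n ^+ 2 * n ^+ 2 by rewrite /s; ring.
  rewrite ler_wpM2r ?exprn_ge0 ?ler0n //.
  have : 1 <= ln n ^+ 2 by rewrite exprn_ege1.
  by clear; lra.
have hP := tilt_lower hp01 hmi s0 hV Q0 (erefl Q).
set P := gnp_Pr _ _ in hP *.
have P0 : 0 < P by apply: lt_le_trans hP; rewrite mulr_gt0 ?expR_gt0.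
set a := Ip_array p (mix x t) + s / Q in hP.
have h1 : - ln P <= a - ln Q.
  have : ln (Q * expR (- a)) <= ln P by rewrite ler_ln ?posrE ?mulr_gt0 ?expR_gt0.
  rewrite lnM ?posrE ?expR_gt0 // expRK; clear; lra.
pose z := n `^ (2 - 1 / (2 * m%:R)).
have hz : n `^ (3 / 2) <= z.
  rewrite /z ler_powR // lerBrDr -lerBrDl.
  have : 1 / (2 * m%:R) <= 1 / 2 :> R.
    by rewrite !div1r lef_pV2 ?posrE ?mulr_gt0 // ?(lt_le_trans _ mR) // ler_peMr.
  by clear; lra.
have z1 : 1 <= z.
  by apply: le_trans hz; rewrite -[leLHS](powRr0 n) ler_powR // divr_ge0.
have hlnQ : - ln Q <= ln n.
  have : ln (t ^+ m) <= ln Q by rewrite ler_ln ?posrE ?exprn_gt0.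
  by rewrite tm ln_powR; move: l0; clear; lra.
have hsQ : s / Q <= 5 * (ln n * z).
  apply: (@le_trans _ _ (s / t ^+ m)).
    by rewrite ler_pM2l // lef_pV2 ?posrE ?exprn_gt0.
  rewrite tm -powRN opprK /s -!mulrA ler_pM2l // mulrCA ler_pM2l //.
  have e32 : 1 + 1 / 2 = 3 / 2 :> R by field.
  apply: le_trans hz; rewrite -{1}(powRr1 (ltW n0)) -powRD; last by rewrite (gt_eqF n0) implybT.
  by rewrite e32.
have hI := Ip_array_mix hp01 hx ht.
have htz : t * (- ln p) * n ^+ 2 <= ln n * z.
  have -> : z = t * n ^+ 2.
    rewrite /z /t -powR_mulrn ?(ltW n0) // -powRD; last by rewrite (gt_eqF n0) implybT.
    by congr (_ `^ _); ring.
  rewrite mulrAC mulrC ler_wpM2r ?mulr_ge0 ?exprn_ge0 ?(ltW t0) ?(ltW n0) //.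
  by move: lp; clear; lra.
have hl : ln n <= ln n * z by rewrite ler_peMr // ltW.
(* The constant 7 is 5 from [s / Q], 1 from mixing and 1 from [- ln Q]. *)
move: h1 hlnQ hsQ hI htz hl; rewrite /a -/n -/z; clear; lra.
Qed.

End LowerBound.

(** * Approximation in cut norm *)

Section CutApproximation.
Variables (R : realType) (N : nat).

(** A sign, a set of rows and a set of columns. *)
Definition rect : finType := (bool * {set 'I_N} * {set 'I_N})%type.

Definition rect_fun (c : rect) (i j : 'I_N) : R :=
  (-1) ^+ c.1.1 * ((i \in c.1.2) && (j \in c.2))%:R.

Definition rect_sum (eps : R) (s : seq rect) (i j : 'I_N) : R :=
  \sum_(c <- s) eps * rect_fun c i j.

Lemma sum_sum_one : \sum_(i < N) \sum_(j < N) 1 = N%:R ^+ 2 :> R.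
Proof. by rewrite !sumr_const card_ord -mulrnA -natrX expnS expn1. Qed.

Lemma sum_sum_setE (w : 'I_N -> 'I_N -> R) (S T : {set 'I_N}) :
  \sum_(i in S) \sum_(j in T) w i j = \sum_i \sum_j w i j * ((i \in S) && (j \in T))%:R.
Proof.
rewrite big_mkcond; apply: eq_bigr => i _; case: ifP => _; last first.
  by rewrite big1 // => j _; rewrite mulr0.
by rewrite big_mkcond; apply: eq_bigr => j _; case: ifP => _; rewrite ?mulr1 ?mulr0.
Qed.

(** Expand the square: the cross term gains [2 eps^2 N^2], and the squared rectangle costs at most
    [eps^2 N^2]. *)
Lemma energy_decrement (z : 'I_N -> 'I_N -> R) (eps : R) (S T : {set 'I_N}) (b : bool) :
  0 < eps -> eps * N%:R ^+ 2 <= (-1) ^+ b * \sum_(i in S) \sum_(j in T) z i j ->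
  \sum_i \sum_j (z i j - eps * rect_fun (b, S, T) i j) ^+ 2 <=
  \sum_i \sum_j z i j ^+ 2 - eps ^+ 2 * N%:R ^+ 2.
Proof.
move=> e0 h.
have -> : \sum_i \sum_j (z i j - eps * rect_fun (b, S, T) i j) ^+ 2 =
  \sum_i \sum_j z i j ^+ 2 - 2 * eps * ((-1) ^+ b * \sum_(i in S) \sum_(j in T) z i j)
  + eps ^+ 2 * \sum_i \sum_j ((i \in S) && (j \in T))%:R.
  rewrite sum_sum_setE !mulr_sumr -sumrB -big_split /=; apply: eq_bigr => i _.
  rewrite !mulr_sumr -sumrB -big_split /=; apply: eq_bigr => j _.
  rewrite /rect_fun /=; case: (_ && _); rewrite /= ?mulr1 ?mulr0; last by ring.
  by case: b {h}; rewrite ?expr1 ?expr0; ring.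
have hc : \sum_i \sum_j ((i \in S) && (j \in T))%:R <= N%:R ^+ 2 :> R.
  apply: (@le_trans _ _ (\sum_(i < N) \sum_(j < N) 1)).
    by apply: ler_sum => i _; apply: ler_sum => j _; case: (_ && _).
  by rewrite sum_sum_one.
have h1 := ler_wpM2l (sqr_ge0 eps) hc.
have h2 := ler_wpM2l (ltW e0) h.
move: h1 h2; rewrite expr2; clear; lra.
Qed.

(* As long as some rectangle violates the bound, subtracting [eps] times its
   signed indicator lowers the energy by [eps^2 N^2]. *)
Lemma cut_approx (y : 'I_N -> 'I_N -> R) (eps : R) (r : nat) : (0 < N)%N -> 0 < eps ->
  \sum_i \sum_j y i j ^+ 2 <= N%:R ^+ 2 -> 1 < r%:R * eps ^+ 2 ->
  exists c : r.-tuple rect, forall S T : {set 'I_N},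
    `| \sum_(i in S) \sum_(j in T) (y i j - rect_sum eps c i j) | <= eps * N%:R ^+ 2.
Proof.
move=> N0 e0 hy hr.
pose good n (c : n.-tuple rect) := forall S T : {set 'I_N},
    `| \sum_(i in S) \sum_(j in T) (y i j - rect_sum eps c i j) | <= eps * N%:R ^+ 2.
(* Either an approximation is found, padded with empty rectangles to length [n], or the energy has
   dropped [n] times. *)
have main n : (exists c : n.-tuple rect, good n c) \/ (exists c : n.-tuple rect,
    \sum_i \sum_j (y i j - rect_sum eps c i j) ^+ 2 <= N%:R ^+ 2 - n%:R * eps ^+ 2 * N%:R ^+ 2).
  elim: n => [|n [[c hc]|[c hc]]].
  - right; exists [tuple]; rewrite mul0r mul0r subr0; apply: le_trans hy.
    rewrite le_eqVlt; apply/orP; left; apply/eqP.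
    by apply: eq_bigr => i _; apply: eq_bigr => j _; rewrite /rect_sum big_nil subr0.
  - left; exists [tuple of (false, finset.set0, finset.set0) :: c] => S T.
    rewrite (eq_bigr (fun i => \sum_(j in T) (y i j - rect_sum eps c i j))); first exact: hc.
    move=> i _; apply: eq_bigr => j _.
    by rewrite /rect_sum big_cons /rect_fun /= !inE mulr0 mulr0 add0r.
  have [g|] := pselect (good n c).
    left; exists [tuple of (false, finset.set0, finset.set0) :: c] => S T.
    rewrite (eq_bigr (fun i => \sum_(j in T) (y i j - rect_sum eps c i j))); first exact: g.
    move=> i _; apply: eq_bigr => j _.
    by rewrite /rect_sum big_cons /rect_fun /= !inE mulr0 mulr0 add0r.
  move=> /existsNP[S /existsNP[T /negP]]; rewrite -ltNge => hST.
  set w := \sum_(i in S) _ in hST.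
  pose b := w < 0.
  right; exists [tuple of (b, S, T) :: c].
  have hb : eps * N%:R ^+ 2 <= (-1) ^+ b * w.
    apply: ltW; apply: lt_le_trans hST _; rewrite /b; case: ltrP => h.
      by rewrite expr1 mulN1r ltr0_norm.
    by rewrite expr0 mul1r ger0_norm.
  have := energy_decrement e0 hb.
  have -> : \sum_i \sum_j (y i j - rect_sum eps c i j - eps * rect_fun (b, S, T) i j) ^+ 2 =
     \sum_i \sum_j (y i j - rect_sum eps [tuple of (b, S, T) :: c] i j) ^+ 2.
    apply: eq_bigr => i _; apply: eq_bigr => j _; congr (_ ^+ _).
    by rewrite /rect_sum big_cons; ring.
  move: hc; rewrite -natr1; clear; lra.
(* After [r] drops the energy would be negative, as [r * eps^2 > 1]. *)
case: (main r) => // -[c hc]; exfalso.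
have h0 : 0 <= \sum_i \sum_j (y i j - rect_sum eps c i j) ^+ 2.
  by apply: sumr_ge0 => i _; apply: sumr_ge0 => j _; exact: sqr_ge0.
have := le_trans h0 hc; rewrite subr_ge0 leNgt => /negP; apply.
by rewrite -[ltLHS]mul1r ltr_pM2r // exprn_gt0 // ltr0n.
Qed.

Lemma card_rect_tuple r : #|{: r.-tuple rect}| = (2 ^ ((1 + 2 * N) * r))%N.
Proof.
rewrite card_tuple !card_prod card_bool -cardsT -powersetT card_powerset cardsT card_ord.
by rewrite expnM; congr (_ ^ _)%N; rewrite [in RHS]mul2n -addnn !expnD expn1 mulnA.
Qed.

End CutApproximation.

(** * Conditional means and relative entropy *)

Section Gibbs.
Variables (R : realType) (N : nat).
Implicit Types (x : 'M[R]_N) (G : sgraph N) (A : pred (sgraph N)) (p : R).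

Definition cond_mean p A : 'M[R]_N :=
  \matrix_(i, j) ((\sum_(G | A G) gnp p G * (G i j)%:R) / gnp_Pr p A).

Variables (p : R) (A : pred (sgraph N)).
Hypothesis hp : 0 < p < 1.
Hypothesis A0 : 0 < gnp_Pr p A.

Let g0 (G : sgraph N) : 0 < gnp p G := gnp_gt0 G hp.

Lemma cond_mean_arrays : arrays (cond_mean p A).
Proof.
split=> [i j|i|i j]; rewrite !mxE.
- rewrite divr_ge0 ?(ltW A0) //=; last first.
    by apply: sumr_ge0 => G _; rewrite mulr_ge0 // ltW.
  rewrite ler_pdivrMr // mul1r; apply: ler_sum => G _.
  by rewrite ler_piMr ?(ltW (g0 G)) // lern1 leq_b1.
- by rewrite big1 ?mul0r // => G _; rewrite sgraph_irr mulr0.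
- by congr (_ / _); apply: eq_bigr => G _; rewrite sgraph_sym.
Qed.

(** With [cond_mean_lt1], this says that no graph of [A] meets a degenerate entry of the conditional
    mean, so [gnpx_log_ratio] holds exactly on [A]. *)
Lemma cond_mean_gt0 G i j : A G -> G i j -> 0 < cond_mean p A i j.
Proof.
move=> AG Gij; rewrite mxE divr_gt0 // (bigD1 G) //= Gij mulr1 ltr_pwDl //.
by apply: sumr_ge0 => G' _; rewrite mulr_ge0 // ltW.
Qed.

Lemma cond_mean_lt1 G i j : A G -> ~~ G i j -> cond_mean p A i j < 1.
Proof.
move=> AG /negbTE Gij; rewrite mxE ltr_pdivrMr // mul1r /gnp_Pr.
rewrite (bigD1 G) //= [ltRHS](bigD1 G) //= Gij mulr0 add0r ltr_pwDl //.
by apply: ler_sum => G' _; rewrite ler_piMr ?(ltW (g0 G')) // lern1 leq_b1.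
Qed.

Lemma cond_mean_sum (f : 'I_N * 'I_N -> bool -> R) :
  \sum_(G | A G) gnp p G * (\sum_(e | up e) f e (G e.1 e.2)) =
  gnp_Pr p A * \sum_(e | up e) (cond_mean p A e.1 e.2 * f e true
     + (1 - cond_mean p A e.1 e.2) * f e false).
Proof.
rewrite mulr_sumr; under eq_bigr => G _ do rewrite mulr_sumr.
rewrite exchange_big /=; apply: eq_bigr => e ue; rewrite !mxE.
set M := \sum_(G | A G) gnp p G * (G e.1 e.2)%:R.
have -> : \sum_(G | A G) gnp p G * f e (G e.1 e.2) =
   M * f e true + (gnp_Pr p A - M) * f e false.
  rewrite /M /gnp_Pr -sumrB !mulr_suml -big_split /=; apply: eq_bigr => G _.
  by case: (G _ _); rewrite /= ?mulr1 ?mulr0; ring.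
by field; rewrite gt_eqF.
Qed.

(* [log_ratio] is affine in the edge indicators, so its conditional mean given [A] is
   [Ip_array p (cond_mean p A)]; then use that the tilted measure of [A] is at most 1. *)
Lemma gibbs_class : gnp_Pr p A <= expR (- Ip_array p (cond_mean p A)).
Proof.
set x := cond_mean p A; set a := Ip_array p x.
have [hx _ _] := cond_mean_arrays.
rewrite expRN -[leRHS]mul1r ler_pdivlMr ?expR_gt0 //.
apply: (@le_trans _ _ (\sum_(G | A G) gnpx x G)); last first.
  rewrite -[leRHS](E_one x) [leLHS]big_mkcond; apply: ler_sum => G _.
  by case: ifP => // _; exact: gnpx_ge0.
have -> : \sum_(G | A G) gnpx x G = \sum_(G | A G) gnp p G * expR (log_ratio p x G).
  apply: eq_bigr => G AG; apply: gnpx_log_ratio => // e ue.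
  by case: ifP => h; [exact: cond_mean_gt0 AG h|apply: cond_mean_lt1 AG _; rewrite h].
apply: (@le_trans _ _ (\sum_(G | A G) gnp p G * (expR a * (1 + (log_ratio p x G - a))))); last first.
  apply: ler_sum => G _; rewrite ler_wpM2l ?(ltW (g0 G)) //.
  rewrite -[leRHS](_ : expR a * expR (log_ratio p x G - a) = _); last first.
    by rewrite -expRD; congr expR; ring.
  by rewrite ler_wpM2l ?expR_ge0 // expR_ge1Dx.
have -> : \sum_(G | A G) gnp p G * (expR a * (1 + (log_ratio p x G - a))) =
   expR a * (gnp_Pr p A * (1 - a) + \sum_(G | A G) gnp p G * log_ratio p x G).
  rewrite /gnp_Pr mulr_suml -big_split mulr_sumr; apply: eq_bigr => G _ /=; ring.
rewrite /log_ratio (cond_mean_sum (fun e => log_ratio1 p (x e.1 e.2))) -/x.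
have -> : \sum_(e | up e) (x e.1 e.2 * log_ratio1 p (x e.1 e.2) true +
    (1 - x e.1 e.2) * log_ratio1 p (x e.1 e.2) false) = a by rewrite /a Ip_arrayE.
by rewrite -mulrDr subrK mulr1 mulrC.
Qed.

End Gibbs.

(** * Union bound over the classes of graphs *)

Section ClassBound.
Variables (R : realType) (k : nat) (H : sgraph k).
Notation m := (num_edges H).

(** Each class has probability at most [expR (- L)], because its conditional mean nearly reaches
    [T]; there are at most [2 ^ ((1 + 2 * N) * r)] classes, and [ln 2 <= 1]. *)
Lemma log_prob_le (N : nat) (p T eps L : R) (r : nat) : (0 < N)%N -> 0 < p < 1 ->
  0 < eps -> 1 < r%:R * eps ^+ 2 ->
  (forall x : 'M[R]_N, arrays x -> T - 2 * m%:R * eps <= array_density H x ->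
     L <= Ip_array p x) ->
  0 < gnp_Pr p (fun G : sgraph N => T <= hom_density R H G) ->
  L <= - ln (gnp_Pr p (fun G : sgraph N => T <= hom_density R H G)) + ((1 + 2 * N) * r)%:R.
Proof.
move=> N0 hp e0 hr hL; set P := gnp_Pr _ _ => P0.
have hy (G : sgraph N) : \sum_i \sum_j adj_mx R G i j ^+ 2 <= N%:R ^+ 2.
  apply: (@le_trans _ _ (\sum_(i < N) \sum_(j < N) 1)).
    apply: ler_sum => i _; apply: ler_sum => j _; rewrite mxE.
    by case: (G i j); rewrite ?expr1n ?expr0n.
  by rewrite sum_sum_one.
have /choice[code hcode] : forall G : sgraph N, exists c : r.-tuple (rect N), forall S T : {set 'I_N},
    `| \sum_(i in S) \sum_(j in T) (adj_mx R G i j - rect_sum eps c i j) | <= eps * N%:R ^+ 2.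
  by move=> G; apply: cut_approx.
pose A c (G : sgraph N) := (T <= hom_density R H G) && (code G == c).
have eP : P = \sum_(c : r.-tuple (rect N)) gnp_Pr p (A c).
  by rewrite /P /gnp_Pr (partition_big code xpredT).
have hA c : gnp_Pr p (A c) <= expR (- L).
  have : 0 <= gnp_Pr p (A c) by apply: sumr_ge0 => G _; exact: ltW (gnp_gt0 G hp).
  rewrite le_eqVlt => /orP[/eqP <-|A0]; first exact: expR_ge0.
  apply: le_trans (gibbs_class hp A0) _; rewrite ler_expR lerN2; apply: hL.
    exact: cond_mean_arrays.
  have [G0 hG0] : exists G, A c G.
    have [/existsP //|] := boolP [exists G, A c G]; rewrite negb_exists => /forallP h.
    by move: A0; rewrite /gnp_Pr big1 ?ltxx // => G AG; have := h G; rewrite AG.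
  have /andP[h1 /eqP h2] := hG0; apply: le_trans (lerB h1 (lexx _)) _.
  rewrite lerBlDr hom_densityE.
  (* One [eps] separates [G0] from the approximant of its class, the other separates that
     approximant from the conditional mean, an average of graphs of the class. *)
  have -> : 2 * m%:R * eps = m%:R * (2 * eps) by ring.
  have [hx _ _] := cond_mean_arrays hp A0.
  apply: density_le_cut => //; first by move=> i j; rewrite mxE ler0n lern1 leq_b1.
  move=> S U.
  have -> : \sum_(i in S) \sum_(j in U) (adj_mx R G0 i j - cond_mean p (A c) i j) =
     \sum_(i in S) \sum_(j in U) (adj_mx R G0 i j - rect_sum eps c i j) +
     \sum_(i in S) \sum_(j in U) (rect_sum eps c i j - cond_mean p (A c) i j).
    rewrite -big_split; apply: eq_bigr => i _; rewrite -big_split; apply: eq_bigr => j _ /=; ring.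
  rewrite -mulrA mulr_natl mulr2n; apply: lerD.
    by have := hcode G0 S U; rewrite h2 => /(le_trans (ler_norm _)).
  rewrite -(ler_pM2l A0).
  have -> : gnp_Pr p (A c) * (\sum_(i in S) \sum_(j in U) (rect_sum eps c i j - cond_mean p (A c) i j)) =
     \sum_(G | A c G) gnp p G * - (\sum_(i in S) \sum_(j in U) (adj_mx R G i j - rect_sum eps c i j)).
    rewrite mulr_sumr; under [RHS]eq_bigr => G _ do rewrite -sumrN mulr_sumr.
    rewrite [RHS]exchange_big /=; apply: eq_bigr => i _.
    rewrite mulr_sumr; under [RHS]eq_bigr => G _ do rewrite -sumrN mulr_sumr.
    rewrite [RHS]exchange_big /=; apply: eq_bigr => j _.
    rewrite mulrBr [in X in _ - X]mxE mulrCA mulfV ?gt_eqF // mulr1 /gnp_Pr mulr_suml -sumrB.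
    by apply: eq_bigr => G _; rewrite mxE; ring.
  rewrite /gnp_Pr mulr_suml; apply: ler_sum => G /andP[_ /eqP hc].
  rewrite ler_wpM2l ?(ltW (gnp_gt0 G hp)) //.
  by have := hcode G S U; rewrite hc -normrN => /(le_trans (ler_norm _)).
have hP : P <= (2 ^ ((1 + 2 * N) * r))%:R * expR (- L).
  rewrite eP -card_rect_tuple mulr_natl -sumr_const; apply: ler_sum => c _; exact: hA.
have : ln P <= ln ((2 ^ ((1 + 2 * N) * r))%:R * expR (- L)).
  by rewrite ler_ln ?posrE ?mulr_gt0 ?expR_gt0 ?ltr0n ?expn_gt0.
rewrite lnM ?posrE ?expR_gt0 ?ltr0n ?expn_gt0 // expRK natrX lnXn ?ltr0n //.
have l2 : ln 2 <= 1 :> R by apply: le_trans (ln_le_sub1 _) _ => //; clear; lra.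
have := ler_wpM2l (ler0n R ((1 + 2 * N) * r)) l2.
rewrite mulr1 mulr_natl; clear; lra.
Qed.

End ClassBound.

(** * Repairing nearly feasible arrays *)

Section Perturbation.
Variables (R : realType) (k : nat) (H : sgraph k).
Notation m := (num_edges H).

(** Sum [Ip1_le] over the entries; the missing mass, the sum of [1 - x i j], is controlled by the
    density deficit because a density is at most the mean entry. *)
Lemma Ip_complete_mx_le (N : nat) (p : R) (x : 'M[R]_N) : (0 < m)%N -> (2 <= N)%N -> 0 < p < 1 ->
  - ln N%:R <= ln p -> arrays x ->
  Ip_array p (complete_mx R N) <= Ip_array p x +
    2 * ln N%:R * (m%:R * N%:R + N%:R ^+ 2 * (array_density H (complete_mx R N) - array_density H x))
    + 2 * N%:R.
Proof.
move=> m0 N2 hp lp hx; have N0 : (0 < N)%N by exact: leq_trans N2.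
have /andP[p0 p1] := hp; have [xi xd xs] := hx.
have n0 : 0 < N%:R :> R by rewrite ltr0n.
have l0 : 0 <= ln N%:R :> R by rewrite ln_ge0 // ler1n.
have S0 : \sum_(e | up e) (1 - x e.1 e.2) <= \sum_(i < N) \sum_(j < N) (1 - x i j).
  rewrite pair_big /= [leLHS]big_mkcond; apply: ler_sum => e _.
  by case: ifP => // _; rewrite subr_ge0; case/andP: (xi e.1 e.2).
have S1 : \sum_(i < N) \sum_(j < N) (1 - x i j) <= m%:R * N%:R +
    N%:R ^+ 2 * (array_density H (complete_mx R N) - array_density H x).
  under eq_bigr => i _ do rewrite sumrB.
  rewrite sumrB sum_sum_one.
  have h1 := density_le_mean N0 m0 xi; have h2 := density_complete_mx_ge R H N0.
  rewrite ler_pdivlMl ?exprn_gt0 // in h1.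
  have : N%:R ^+ 2 * (1 - m%:R / N%:R) <= N%:R ^+ 2 * array_density H (complete_mx R N).
    by rewrite ler_wpM2l // exprn_ge0 // ltW.
  have -> : N%:R ^+ 2 * (1 - m%:R / N%:R) = N%:R ^+ 2 - m%:R * N%:R :> R.
    by field; rewrite gt_eqF.
  move: h1; rewrite mulrBr; clear; lra.
have hsum : Ip_array p (complete_mx R N) - Ip_array p x -
    2 * ln N%:R * \sum_(e | up e) (1 - x e.1 e.2) <= 2 * N%:R.
  rewrite !Ip_arrayE mulr_sumr -!sumrB.
  have -> : 2 * N%:R = (2 / N%:R) * N%:R ^+ 2 :> R by field; rewrite gt_eqF.
  apply: sum_up_le => [|e ue]; first by rewrite divr_ge0 // ltW.
  rewrite mxE neq_ltn; rewrite [up e]/up in ue; rewrite ue Ip1 //.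
  have := Ip1_le N2 hp (xi e.1 e.2).
  have /andP[v0 v1] := xi e.1 e.2.
  have : (1 - x e.1 e.2) * - ln p <= (1 - x e.1 e.2) * ln N%:R.
    by rewrite ler_wpM2l ?subr_ge0 //; move: lp; clear; lra.
  clear; lra.
have := ler_wpM2l (mulr_ge0 (ler0n R 2) l0) (le_trans S0 S1).
move: hsum; clear; lra.
Qed.

(** Mixing gains [t ^+ m] times the room above [T], which pays for the shortfall [d], so the mixed
    array is feasible. *)
Lemma perturb_mix (N : nat) (p T d t L : R) (x : 'M[R]_N) : 0 < p < 1 ->
  - ln N%:R <= ln p -> 0 <= t <= 1 -> arrays x -> 0 <= d ->
  T - d <= array_density H x -> d <= t ^+ m * (array_density H (complete_mx R N) - T) ->
  (forall y : 'M[R]_N, arrays y -> T <= array_density H y -> L <= Ip_array p y) ->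
  L <= Ip_array p x + t * ln N%:R * N%:R ^+ 2.
Proof.
move=> hp lp ht hx d0 hT hd hL; have /andP[t0 t1] := ht.
have hm := mix_arrays ht hx.
apply: (@le_trans _ _ (Ip_array p (mix x t))).
  apply: hL => //.
  have := density_mix H ht hx.
  set K := array_density H (complete_mx R N) in hd *; set X := array_density H x in hT *.
  set M := array_density H (mix x t).
  have tm0 : 0 <= t ^+ m by exact: exprn_ge0.
  have tm1 : 0 <= 1 - t ^+ m by rewrite subr_ge0 exprn_ile1.
  have h1 : (1 - t ^+ m) * (K - X) <= (1 - t ^+ m) * (K - T + d).
    by rewrite ler_wpM2l //; move: hT; clear; lra.
  have h2 : 0 <= t ^+ m * d by exact: mulr_ge0.
  move: h1 h2 hd; clear; lra.
apply: le_trans (Ip_array_mix hp hx ht) _.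
rewrite lerD2l ler_wpM2r ?exprn_ge0 ?ler0n // ler_wpM2l //.
by move: lp; clear; lra.
Qed.

(** With little room [r] above [T], [x] has deficit at most [r + d], and the complete array costs
    little more than [x]. *)
Lemma perturb_complete_mx (N : nat) (p T d r L : R) (x : 'M[R]_N) : (0 < m)%N -> (2 <= N)%N ->
  0 < p < 1 -> - ln N%:R <= ln p -> arrays x ->
  T - d <= array_density H x -> array_density H (complete_mx R N) - T <= r ->
  L <= Ip_array p (complete_mx R N) ->
  L <= Ip_array p x + 2 * ln N%:R * (m%:R * N%:R + N%:R ^+ 2 * (r + d)) + 2 * N%:R.
Proof.
move=> m0 N2 hp lp hx hT hr hL; apply: (le_trans hL).
apply: le_trans (Ip_complete_mx_le m0 N2 hp lp hx) _.
rewrite lerD2r lerD2l; apply: ler_wpM2l.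
  by rewrite mulr_ge0 // ln_ge0 // ler1n; apply: leq_trans N2.
rewrite lerD2l ler_wpM2l ?exprn_ge0 ?ler0n //.
by move: hT hr; clear; lra.
Qed.

(** Each copy of [H] needs at least one edge. Crude, but it bounds [p] from below when [T] is
    bounded below. *)
Lemma E_density_le (N : nat) (p : R) : (0 < m)%N -> 0 < p < 1 -> (0 < N)%N ->
  gnp_E p (fun G : sgraph N => hom_density R H G) <= p.
Proof.
move=> m0 /andP[p0 p1] N0.
have -> : gnp_E p (fun G : sgraph N => hom_density R H G) = (N%:R ^+ k)^-1 *
    \sum_(q : {ffun 'I_k -> 'I_N} | loopless H q) p ^+ #|edge_img H q|.
  rewrite /gnp_E; under eq_bigr => G _ do rewrite hom_densityE density_adj_mx mulrCA mulr_sumr.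
  rewrite -mulr_sumr exchange_big /=; congr (_ * _); apply: eq_bigr => q hq.
  under eq_bigr => G _ do rewrite gnpE.
  rewrite E_has_edges => [|s]; last exact: edge_img_up.
  by rewrite (eq_bigr (fun=> p)) ?prodr_const // => s _; rewrite mxE.
rewrite -[leRHS](@avg_const R k N) // ler_wpM2l ?invr_ge0 ?exprn_ge0 ?ler0n //.
rewrite [leLHS]big_mkcond; apply: ler_sum => q _; case: ifP => _; last exact: ltW.
rewrite -[leRHS]expr1 ler_wiXn2l ?(ltW p0) ?(ltW p1) // card_gt0.
move: m0; rewrite num_edgesE => /card_gt0P[e eE].
by apply/set0Pn; exists (ordp (q e.1, q e.2)); apply/imsetP; exists e.
Qed.

Lemma prob_gt0_threshold (N : nat) (p T : R) :
  0 < gnp_Pr p (fun G : sgraph N => T <= hom_density R H G) ->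
  T <= array_density H (complete_mx R N).
Proof.
move=> P0; have [G hG] : exists G : sgraph N, T <= hom_density R H G.
  have [/existsP //|] := boolP [exists G : sgraph N, T <= hom_density R H G].
  rewrite negb_exists => /forallP h.
  by move: P0; rewrite /gnp_Pr big1 ?ltxx // => G hG; have := h G; rewrite hG.
apply: le_trans hG _; rewrite hom_densityE; apply: density_mono => i j.
rewrite !mxE ler0n ler_nat /=.
by have [<-|_] := eqVneq i j; rewrite ?sgraph_irr ?leq_b1.
Qed.

Lemma exists_steps (eps : R) : 0 < eps <= 1 ->
  exists r : nat, 1 < r%:R * eps ^+ 2 /\ r%:R <= 2 / eps ^+ 2.
Proof.
move=> /andP[e0 e1]; have e2 : 0 < eps ^+ 2 by exact: exprn_gt0.
have w0 : 0 <= (eps ^+ 2)^-1 by rewrite invr_ge0 ltW.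
have /andP[h1 h2] := truncn_itv w0.
exists (Num.truncn (eps ^+ 2)^-1).+1; split.
  by rewrite -ltr_pdivrMr // mul1r.
have : 1 <= (eps ^+ 2)^-1 by rewrite invf_ge1 // exprn_ile1 // ltW.
rewrite -natr1; move: h1; clear; lra.
Qed.

End Perturbation.

(** * Rates *)

Section MeanFieldUpper.
Variables (R : realType) (k : nat) (H : sgraph k).
Notation m := (num_edges H).

Lemma log_prob_le_error (N : nat) (p T eps E1 L : R) : (0 < N)%N -> 0 < p < 1 ->
  0 < eps <= 1 ->
  (forall x : 'M[R]_N, arrays x -> T - 2 * m%:R * eps <= array_density H x ->
     L <= Ip_array p x + E1) ->
  0 < gnp_Pr p (fun G : sgraph N => T <= hom_density R H G) ->
  L <= - ln (gnp_Pr p (fun G : sgraph N => T <= hom_density R H G)) + E1 + 6 * (N%:R / eps ^+ 2).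
Proof.
move=> N0 hp heps hL P0; have /andP[e0 e1] := heps.
have [r [r1 r2]] := exists_steps heps.
have hL' : forall x : 'M[R]_N, arrays x -> T - 2 * m%:R * eps <= array_density H x ->
     L - E1 <= Ip_array p x.
  by move=> x hx hT; rewrite lerBlDr; exact: hL.
have := log_prob_le N0 hp e0 r1 hL' P0.
(* Here 6 comes from [1 + 2 * N <= 3 * N] and [r <= 2 / eps^2]. *)
have : ((1 + 2 * N) * r)%:R <= 6 * (N%:R / eps ^+ 2).
  rewrite natrM; apply: (@le_trans _ _ (3 * N%:R * r%:R)).
    by rewrite ler_wpM2r ?ler0n // -natrM ler_nat; lia.
  have := ler_wpM2l (mulr_ge0 (ler0n R 3) (ler0n R N)) r2.
  clear; lra.
clear; lra.
Qed.

Lemma powR_div_sqr (n a : R) (j : nat) : 0 < n ->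
  n / ((n `^ (- a)) ^+ j) ^+ 2 = n `^ (1 + 2 * j%:R * a).
Proof.
move=> n0; rewrite -exprM -powR_mulrn ?powR_ge0 // -powRrM -powRN.
rewrite -{1}(powRr1 (ltW n0)) -powRD; last by rewrite (gt_eqF n0) implybT.
by congr (_ `^ _); rewrite natrM; ring.
Qed.

Lemma mean_field_sparse (N : nat) (p T L : R) : (0 < m)%N -> (4 <= N)%N ->
  p_range m N p -> 2 * m%:R <= N%:R :> R ->
  8 * m%:R <= N%:R `^ (1 / (2 * m%:R + 1)) :> R ->
  T <= array_density H (complete_mx R N) / 2 ->
  (forall x : 'M[R]_N, arrays x -> T <= array_density H x -> L <= Ip_array p x) ->
  0 < gnp_Pr p (fun G : sgraph N => T <= hom_density R H G) ->
  L <= - ln (gnp_Pr p (fun G : sgraph N => T <= hom_density R H G)) +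
    (8 * m%:R + 6) * (ln N%:R * N%:R `^ (2 - 1 / (2 * m%:R + 1))).
Proof.
move=> m0 N4 hp N2m N8m hT hL P0; have N0 : (0 < N)%N by exact: leq_trans N4.
have hp01 := p_range_itv N0 hp; have [lp _] := p_range_ln N0 hp.
have l1 := ln_nat_ge1 R N4.
have n0 : 0 < N%:R :> R by rewrite ltr0n.
have n1 : 1 <= N%:R :> R by rewrite ler1n.
have mR : 1 <= m%:R :> R by rewrite ler1n.
(* With [eps = N^(- m d)] and [t] of order [N^(- d)], this [d] balances the class cost [N / eps^2]
   with the mixing cost [t N^2], up to the logarithm. *)
set d := 1 / (2 * m%:R + 1) in N8m *.
have d0 : 0 < d by rewrite divr_gt0 //; move: mR; clear; lra.
pose y : R := N%:R `^ (- d); have y0 : 0 < y by rewrite powR_gt0.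
have y1 : 8 * m%:R * y <= 1.
  by rewrite /y powRN ler_pdivrMr ?powR_gt0 // mul1r.
have m8 : 1 <= 8 * m%:R :> R by move: mR; clear; lra.
have yle1 : y <= 1 by apply: le_trans y1; rewrite ler_peMl // ltW.
pose eps := y ^+ m.
have e0 : 0 < eps by exact: exprn_gt0.
have heps : 0 < eps <= 1 by rewrite e0 exprn_ile1 // ltW.
have K2 : 1 / 2 <= array_density H (complete_mx R N).
  apply: le_trans (density_complete_mx_ge R H N0).
  have : m%:R / N%:R <= 1 / 2 :> R by rewrite ler_pdivrMr //; move: N2m; clear; lra.
  by clear; lra.
set t := 8 * m%:R * y in y1.
have t0 : 0 <= t by rewrite mulr_ge0 ?(ltW y0) //; move: m8; clear; lra.
have ht : 0 <= t <= 1 by rewrite t0.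
(* As the room above [T] is at least 1/4, the factor [8 m] in [t] lets the gain [t ^+ m / 4] cover
   the counting error [2 m eps]. *)
have htm : 8 * m%:R * eps <= t ^+ m.
  rewrite /t exprMn ler_pM2r //.
  by rewrite ler_eXnr.
have key (x : 'M[R]_N) : arrays x -> T - 2 * m%:R * eps <= array_density H x ->
    L <= Ip_array p x + t * ln N%:R * N%:R ^+ 2.
  move=> hx hTx; apply: (perturb_mix hp01 lp ht hx _ hTx _ hL).
    by rewrite mulr_ge0 ?(ltW e0) // mulr_ge0 // ler0n.
  have h1 : t ^+ m * (1 / 4) <= t ^+ m * (array_density H (complete_mx R N) - T).
    rewrite ler_wpM2l ?exprn_ge0 //; move: K2 hT; clear; lra.
  by move: h1 htm; clear; lra.
apply: le_trans (log_prob_le_error N0 hp01 heps key P0) _.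
have dm : 2 * m%:R + 1 != 0 :> R by rewrite gt_eqF //; move: mR; clear; lra.
have -> : N%:R / eps ^+ 2 = N%:R `^ (2 - d).
  by rewrite powR_div_sqr //; congr (_ `^ _); rewrite /d; field.
set z := N%:R `^ (2 - d).
have z0 : 0 <= z by exact: powR_ge0.
have -> : t * ln N%:R * N%:R ^+ 2 = 8 * m%:R * (ln N%:R * z).
  have -> : z = y * N%:R ^+ 2.
    rewrite /z /y -powR_mulrn ?(ltW n0) // -powRD; last by rewrite (gt_eqF n0) implybT.
    by congr (_ `^ _); ring.
  by rewrite /t; ring.
have : z <= ln N%:R * z by rewrite ler_peMl.
clear; lra.
Qed.

(* Here [T] may be so close to [t(K_N)] that mixing gains too little; then the
   array is almost complete and the complete array itself is a cheap competitor. *)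
Lemma mean_field_dense (N : nat) (p T L : R) : (0 < m)%N -> (4 <= N)%N ->
  p_range m N p ->
  (forall x : 'M[R]_N, arrays x -> T <= array_density H x -> L <= Ip_array p x) ->
  0 < gnp_Pr p (fun G : sgraph N => T <= hom_density R H G) ->
  L <= - ln (gnp_Pr p (fun G : sgraph N => T <= hom_density R H G)) +
    (10 * m%:R + 9) * (ln N%:R * N%:R `^ (2 - 1 / (2 * m%:R + 3))).
Proof.
move=> m0 N4 hp hL P0; have N0 : (0 < N)%N by exact: leq_trans N4.
have N2 : (2 <= N)%N by exact: leq_trans N4.
have hp01 := p_range_itv N0 hp; have [lp _] := p_range_ln N0 hp.
have l1 := ln_nat_ge1 R N4.
have n0 : 0 < N%:R :> R by rewrite ltr0n.
have n1 : 1 <= N%:R :> R by rewrite ler1n.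
have mR : 1 <= m%:R :> R by rewrite ler1n.
(* Now [eps = t ^+ m.+1]: the extra power of [t] ensures that when mixing fails the room above [T]
   is at most [2 m t]. This [d] again balances [N / eps^2] with [t N^2]. *)
set d := 1 / (2 * m%:R + 3).
have d3 : 0 < 2 * m%:R + 3 :> R by move: mR; clear; lra.
have d0 : 0 < d by rewrite divr_gt0.
have d1 : d <= 1 by rewrite ler_pdivrMr //; move: mR; clear; lra.
pose t : R := N%:R `^ (- d); have t0 : 0 < t by rewrite powR_gt0.
have t1 : t <= 1.
  by rewrite /t -[leRHS](powRr0 N%:R) ler_powR // oppr_le0 ltW.
pose eps := t ^+ m.+1.
have e0 : 0 < eps by exact: exprn_gt0.
have heps : 0 < eps <= 1 by rewrite e0 exprn_ile1 // ltW.
have ht : 0 <= t <= 1 by rewrite ltW.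
set z := N%:R `^ (2 - d).
have ez : z = t * N%:R ^+ 2.
  rewrite /z /t -powR_mulrn ?(ltW n0) // -powRD; last by rewrite (gt_eqF n0) implybT.
  by congr (_ `^ _); ring.
have z0 : 0 <= z by exact: powR_ge0.
have zl : z <= ln N%:R * z by rewrite ler_peMl.
have nz : N%:R <= z.
  by rewrite -{1}(powRr1 (ltW n0)) /z ler_powR //; move: d1; clear; lra.
have key (x : 'M[R]_N) : arrays x -> T - 2 * m%:R * eps <= array_density H x ->
    L <= Ip_array p x + (10 * m%:R + 3) * (ln N%:R * z).
  move=> hx hTx.
  have [hA|hB] := leP (2 * m%:R * eps) (t ^+ m * (array_density H (complete_mx R N) - T)).
    apply: le_trans (perturb_mix hp01 lp ht hx _ hTx hA hL) _.
      by rewrite mulr_ge0 ?(ltW e0) // mulr_ge0 // ler0n.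
    have -> : t * ln N%:R * N%:R ^+ 2 = ln N%:R * z by rewrite ez; ring.
    rewrite lerD2l ler_peMl //; first exact: le_trans zl.
    by move: mR; clear; lra.
  have hB' : array_density H (complete_mx R N) - T <= 2 * m%:R * t.
    rewrite -(ler_pM2l (exprn_gt0 m t0)); apply: le_trans (ltW hB) _.
    by rewrite /eps exprS le_eqVlt; apply/orP; left; apply/eqP; ring.
  apply: le_trans (perturb_complete_mx m0 N2 hp01 lp hx hTx hB' _) _.
    apply: hL; first exact: complete_mx_arrays.
    exact: prob_gt0_threshold P0.
  have ete : eps <= t by rewrite /eps exprS ler_piMr ?(ltW t0) // exprn_ile1 // ltW.
  have h1 : m%:R * N%:R + N%:R ^+ 2 * (2 * m%:R * t + 2 * m%:R * eps) <= 5 * m%:R * z.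
    have h2 : m%:R * N%:R <= m%:R * z by rewrite ler_wpM2l // ler0n.
    have h3 : N%:R ^+ 2 * m%:R * eps <= N%:R ^+ 2 * m%:R * t.
      by rewrite ler_wpM2l // mulr_ge0 ?ler0n // exprn_ge0 // ltW.
    rewrite {}ez in h2 *; move: h2 h3; clear; lra.
  have := ler_wpM2l (mulr_ge0 (ler0n R 2) (le_trans ler01 l1)) h1.
  move: zl nz z0; clear; lra.
apply: le_trans (log_prob_le_error N0 hp01 heps key P0) _.
have -> : N%:R / eps ^+ 2 = z.
  rewrite powR_div_sqr //; congr (_ `^ _); rewrite /d -natr1; field.
  by rewrite gt_eqF.
move: zl; clear; lra.
Qed.

(** The integer form of [rate_exponent], for [a] edges and [b] vertices. For [b >= 6] compare
    coefficients; for smaller [b] the edge count bounds [a]. *)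
Lemma rate_nat (a b : nat) : (0 < a)%N -> (2 * a <= b * b.-1)%N ->
  (2 <= b)%N /\ (16 * a * (2 * a + 1) <= b * (a + 3) * (6 * a + 4))%N.
Proof.
move=> a0 hk; have b2 : (2 <= b)%N.
  by case: b hk => [|[|n]] //; rewrite ?muln0 ?mul0n; lia.
split=> //; have [b6|b6] := leqP 6 b.
  apply: (@leq_trans (6 * (a + 3) * (6 * a + 4))); first by nia.
  by rewrite -!mulnA leq_mul2r b6 orbT.
by move: b b2 b6 hk => [|[|[|[|[|[|b]]]]]] //= _ _ hk; nia.
Qed.

(* Makes [N^(2 - 1/(2m+1))] at most [N^(2 - B2) p^(16m/(k(5+8m)))] at the smallest
   admissible [p], namely [N^(-1/(m+3))]. *)
Lemma rate_exponent : (0 < m)%N ->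
  1 / (5 + 8 * m%:R) + 16 * m%:R / (k%:R * (5 + 8 * m%:R)) / (m%:R + 3) <=
  1 / (2 * m%:R + 1) :> R.
Proof.
move=> m0; have hk := num_edges_le H.
have [k2 key] := rate_nat m0 hk.
have kR : 0 < k%:R :> R by rewrite ltr0n (leq_trans _ k2).
have mR : 0 < m%:R :> R by rewrite ltr0n.
have : 16 * m%:R * (2 * m%:R + 1) <= k%:R * (m%:R + 3) * (6 * m%:R + 4) :> R.
  by have := key; rewrite -(ler_nat R) !(natrM, natrD).
set a := m%:R in mR *; set b := k%:R in kR *; move=> h.
have -> : 1 / (5 + 8 * a) + 16 * a / (b * (5 + 8 * a)) / (a + 3) =
   (b * (a + 3) + 16 * a) / (b * (5 + 8 * a) * (a + 3)).
  by field; rewrite !gt_eqF //; move: mR kR; clear; lra.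
rewrite ler_pdivrMr ?mulr_gt0 //; try by move: mR; clear; lra.
rewrite mul1r ler_pdivlMl; last by move: mR; clear; lra.
by move: h; clear; lra.
Qed.

End MeanFieldUpper.

(** * Sparse and dense regimes combined *)

Section MeanField.
Variables (R : realType) (k : nat) (H : sgraph k).
Notation m := (num_edges H).

Lemma mean_field_upper (u : R) : (0 < m)%N -> 1 < u ->
  exists2 C : R, 0 <= C & exists N0 : nat, forall (N : nat) (p L : R), (N0 <= N)%N ->
    p_range m N p ->
    let T := u * gnp_E p (fun G : sgraph N => hom_density R H G) in
    0 < gnp_Pr p (fun G : sgraph N => T <= hom_density R H G) ->
    (forall x : 'M[R]_N, arrays x -> T <= array_density H x -> L <= Ip_array p x) ->
    L <= - ln (gnp_Pr p (fun G : sgraph N => T <= hom_density R H G)) +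
      C * (ln N%:R * (N%:R `^ (2 - 1 / (5 + 8 * m%:R)) *
        p `^ (16 * m%:R / (k%:R * (5 + 8 * m%:R))))).
Proof.
move=> m0 u1; set a := 1 / (5 + 8 * m%:R); set s := 16 * m%:R / _.
have mR : 1 <= m%:R :> R by rewrite ler1n.
have m58 : 0 < 5 + 8 * m%:R :> R by move: mR; clear; lra.
have s0 : 0 <= s by rewrite divr_ge0 ?mulr_ge0 ?ler0n // ltW.
have u0 : 0 < u by exact: lt_trans u1.
(* In the dense regime [T > 1/4], while [T <= u * p], so [p >= p0] and the power of [p] in the error
   is absorbed into the constant [Cd]. *)
pose p0 : R := (4 * u)^-1.
have p00 : 0 < p0 by rewrite invr_gt0 mulr_gt0.
have ps0 : 0 < p0 `^ s by exact: powR_gt0.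
pose Cs : R := 8 * m%:R + 6; pose Cd := (10 * m%:R + 9) / p0 `^ s.
have Cs0 : 0 <= Cs by rewrite /Cs; move: mR; clear; lra.
have Cd0 : 0 <= Cd by rewrite divr_ge0 ?(ltW ps0) //; move: mR; clear; lra.
exists (Cs + Cd); first exact: addr_ge0.
have d0 : 0 < 1 / (2 * m%:R + 1) :> R by rewrite divr_gt0 //; move: mR; clear; lra.
have [Na hNa] := powR_ge_eventually (8 * m%:R) d0.
exists (maxn (maxn 4 (2 * m)) Na) => N p L; rewrite !geq_max => /andP[/andP[N4 N2m] /hNa ha] hp T P0 hL.
have N0 : (0 < N)%N by exact: leq_trans N4.
have hp01 := p_range_itv N0 hp; have /andP[pp p1] := hp01.
have n0 : 0 < N%:R :> R by rewrite ltr0n.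
have n1 : 1 <= N%:R :> R by rewrite ler1n.
have l1 := ln_nat_ge1 R N4.
have l0 : 0 <= ln N%:R :> R by exact: le_trans l1.
have N2mR : 2 * m%:R <= N%:R :> R by rewrite -natrM ler_nat.
set W := ln N%:R * _.
have W0 : 0 <= W by rewrite !mulr_ge0 ?powR_ge0.
have [hT|hT] := leP T (array_density H (complete_mx R N) / 2).
  apply: le_trans (mean_field_sparse m0 N4 hp N2mR ha hT hL P0) _.
  rewrite lerD2l; apply: (@le_trans _ _ (Cs * W)); last by rewrite ler_wpM2r // lerDl.
  rewrite ler_wpM2l // ler_wpM2l //.
  apply: (@le_trans _ _ (N%:R `^ (2 - a) * N%:R `^ (- (s / (m%:R + 3))))); last first.
    by rewrite ler_wpM2l ?powR_ge0 // p_range_pow.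
  rewrite -powRD; last by rewrite (gt_eqF n0) implybT.
  rewrite ler_powR //.
  by have := rate_exponent R m0; rewrite -/a -/s; clear; lra.
apply: le_trans (mean_field_dense m0 N4 hp hL P0) _.
rewrite lerD2l; apply: (@le_trans _ _ (Cd * W)); last by rewrite ler_wpM2r // lerDr.
have hp0 : p0 <= p.
  have hE := E_density_le m0 hp01 N0.
  have h1 : T <= u * p by rewrite ler_wpM2l // ltW.
  have h2 : 1 / 2 <= array_density H (complete_mx R N).
    apply: le_trans (density_complete_mx_ge R H N0).
    have : m%:R / N%:R <= 1 / 2 :> R by rewrite ler_pdivrMr //; move: N2mR; clear; lra.
    by clear; lra.
  rewrite /p0 -div1r ler_pdivrMr ?mulr_gt0 //; move: h1 h2 hT; clear; lra.
have -> : Cd * W = (10 * m%:R + 9) * (ln N%:R * (N%:R `^ (2 - a) * (p `^ s / p0 `^ s))).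
  by rewrite /Cd /W; ring.
apply: ler_wpM2l; first by move: mR; clear; lra.
apply: ler_wpM2l => //.
rewrite -[leLHS]mulr1; apply: ler_pM; rewrite ?powR_ge0 //.
  rewrite ler_powR // lerD2l lerN2 /a !div1r lef_pV2 ?posrE //; move: mR; clear; lra.
rewrite ler_pdivlMr // mul1r; apply: ge0_ler_powR; rewrite ?nnegrE ?(ltW pp) ?(ltW p00) //.
Qed.

End MeanField.

(** * The two-sided estimate of the ratio *)

Theorem theorem1p2 (R : realType) (k : nat) (H : sgraph k) (u : R)
    (Hm : (1 <= num_edges H)%N) (Hu : 1 < u) :
  let m : R := (num_edges H)%:R in
  let Delta : R := (max_degree H)%:R in
  let b1 : R := 1 in
  let b2 : R := 1 / (2 * m) in
  let b3 : R := Delta in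
  let B1 : R := (9 + 8 * m) / (5 + 8 * m) in
  let B2 : R := 1 / (5 + 8 * m) in
  let B3 : R := Delta - 16 * m / (k%:R * (5 + 8 * m)) in
  exists c C : R, exists N0 : nat,
  forall (N : nat) (p : R), (N0 <= N)%N ->
    N%:R `^ (- (1 / (m + 3))) <= p <= 1 - N%:R^-1 ->
    let X := fun G : sgraph N => hom_density R H G in
    let prob := gnp_Pr p (fun G : sgraph N => u * gnp_E p X <= X G) in
    (* [prob = 0] is the degenerate case where the ratio reads +oo / +oo. *)
    (prob = 0 -> psi N H p u = +oo%E) /\
    (0 < prob ->
      ((1 - c * ln N%:R `^ b1 / (N%:R `^ b2 * p `^ b3))%:E
        <= psi N H p u / (- ln prob)%:E
        <= (1 + C * ln N%:R `^ B1 / (N%:R `^ B2 * p `^ B3))%:E)%E).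
Proof.
move=> m Delta b1 b2 b3 B1 B2 B3.
have mR : 1 <= m by rewrite ler1n.
have [c1 [c10 [Na hNa]]] := upper_tail Hm Hu.
have [C C0 [Nb hNb]] := mean_field_upper Hm Hu.
(* The additive errors of [log_prob_ge] and [mean_field_upper], divided by the bound [c1 * V <= Lam]
   from [upper_tail]. *)
exists (7 / c1), (C / c1), (maxn 4 (maxn Na Nb)) => N p.
rewrite !geq_max => /and3P[N4 hNaN hNbN] hp X prob.
have N0 : (0 < N)%N by exact: leq_trans N4.
have hp01 := p_range_itv N0 hp; have /andP[pp p1] := hp01.
pose T := u * gnp_E p X.
split=> [prob0|prob0].
  (* A feasible array would, by [tilted_prob_ge] at [t = 1], give a graph in the event, and every
     graph has positive weight. *)
  rewrite /psi (_ : [set x | _]%classic = set0) ?image_set0 ?ereal_inf0 //.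
  apply/seteqP; split => // x /= [hx hT].
  have h1 : 0 < (1 : R) <= 1 by rewrite ltr01 lexx.
  have := tilted_prob_ge N0 hx hT h1; rewrite expr1n.
  rewrite big1 ?ler10 // => G hG; exfalso.
  move: prob0 => /eqP; rewrite gt_eqF // /prob /gnp_Pr (bigD1 G) //=.
  rewrite ltr_pwDl ?gnp_gt0 // sumr_ge0 // => G' _; exact: ltW (gnp_gt0 G' hp01).
have n0 : 0 < N%:R :> R by rewrite ltr0n.
have l1 := ln_nat_ge1 R N4.
have l0 : 0 <= ln N%:R :> R by exact: le_trans l1.
pose Lam := - ln prob.
pose V : R := N%:R ^+ 2 * p ^+ max_degree H.
have V0 : 0 < V by rewrite mulr_gt0 // exprn_gt0.
have cV0 : 0 < c1 * V by exact: mulr_gt0.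
have hLam : c1 * V <= Lam.
  have h := hNa N p hNaN hp.
  have : ln prob <= ln (expR (- (c1 * V))) by rewrite ler_ln ?posrE ?expR_gt0.
  by rewrite expRK /Lam; clear; lra.
have Lam0 : 0 < Lam by exact: lt_le_trans hLam.
pose feas := [set x : 'M[R]_N | arrays x /\ T <= array_density H x]%classic.
have foff : feas (complete_mx R N).
  split; first exact: complete_mx_arrays.
  exact: prob_gt0_threshold prob0.
have psi_lb (b : R) : (forall x : 'M[R]_N, arrays x -> T <= array_density H x -> b <= Ip_array p x) ->
    (b%:E <= psi N H p u)%E.
  move=> hb; apply: le_ereal_inf_tmp => _ [x [hx hT] <-].
  by rewrite lee_fin; exact: hb.
have psi_ub (x : 'M[R]_N) : feas x -> (psi N H p u <= (Ip_array p x)%:E)%E.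
  by move=> hx; apply: ereal_inf_lbound; exists x.
have psi0 : (0%:E <= psi N H p u)%E by apply: psi_lb => x hx _; exact: Ip_array_ge0.
have psi_fin : psi N H p u \is a fin_num.
  rewrite fin_numE; apply/andP; split; first by rewrite gt_eqF // (lt_le_trans _ psi0) // ltNyr.
  by rewrite lt_eqF // (le_lt_trans (psi_ub _ foff)) // ltry.
have [L eL] : exists L : R, psi N H p u = L%:E.
  by exists (fine (psi N H p u)); rewrite fineK.
have hL (x : 'M[R]_N) : arrays x -> T <= array_density H x -> L <= Ip_array p x.
  by move=> hx hT; rewrite -lee_fin -eL; apply: psi_ub.
rewrite eL -/Lam inver gt_eqF // -EFinM !lee_fin.
have pD : p `^ Delta = p ^+ max_degree H by rewrite powR_mulrn // ltW.
apply/andP; split.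
  pose z := ln N%:R * N%:R `^ (2 - 1 / (2 * m)).
  have hz : Lam - 7 * z <= L.
    rewrite -lee_fin -eL; apply: psi_lb => x hx hT.
    have := log_prob_ge Hm N4 hp hx hT.
    rewrite -/Lam -/z; clear; lra.
  have z0 : 0 <= 7 * z by rewrite !mulr_ge0 ?powR_ge0.
  rewrite ler_pdivlMr // mulrBl mul1r.
  apply: le_trans hz; rewrite lerD2l lerN2.
  apply: (@le_trans _ _ (7 * z / (c1 * V) * Lam)).
    by rewrite mulrAC ler_pdivlMr // ler_wpM2l.
  rewrite ler_wpM2r ?(ltW Lam0) // le_eqVlt; apply/orP; left; apply/eqP.
  rewrite /z powRB ?(gt_eqF n0) ?implybT // powR_mulrn ?(ltW n0) // /b1 powRr1 // /b3 pD /V.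
  rewrite -/b2; have := powR_gt0 b2 n0.
  set y := N%:R `^ b2 => y0; have pD0 : 0 < p ^+ max_degree H by exact: exprn_gt0.
  by field; rewrite !gt_eqF.
pose z := ln N%:R * (N%:R `^ (2 - B2) * p `^ (16 * m / (k%:R * (5 + 8 * m)))).
have hz : L <= Lam + C * z by exact: hNb.
have z0 : 0 <= C * z by rewrite !mulr_ge0 ?powR_ge0.
rewrite ler_pdivrMr // mulrDl mul1r; apply: (le_trans hz); rewrite lerD2l.
apply: (@le_trans _ _ (C * z / (c1 * V) * Lam)).
  by rewrite mulrAC ler_pdivlMr // ler_wpM2l.
rewrite ler_wpM2r ?(ltW Lam0) //.
(* The estimate carries a single logarithm; [B1 >= 1] and [ln N >= 1] give the stated power. *)
have lB : ln N%:R <= ln N%:R `^ B1.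
  rewrite -{1}(powRr1 l0) ler_powR // ler_pdivlMr ?mul1r; move: mR; clear; lra.
have -> : C * z / (c1 * V) = C / c1 * ln N%:R / (N%:R `^ B2 * p `^ B3).
  rewrite /z /B3 (powRB (x := p)) ?(gt_eqF pp) ?implybT // pD.
  rewrite powRB ?(gt_eqF n0) ?implybT // powR_mulrn ?(ltW n0) // /V.
  set q := p `^ _; have q0 : 0 < q by exact: powR_gt0.
  have := powR_gt0 B2 n0; set y := N%:R `^ B2 => y0.
  have pD0 : 0 < p ^+ max_degree H by exact: exprn_gt0.
  by field; rewrite !gt_eqF.
by rewrite ler_wpM2r ?invr_ge0 ?mulr_ge0 ?powR_ge0 // ler_wpM2l // divr_ge0 // ltW.
Qed.
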